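(* Let $z_0 \in \mathbb{C}$, let $n \ge 1$ be an integer, and let $f = h + \overline{g}$, where $$h(z) = \sum_{k=-n}^\infty a_k (z-z_0)^k, \qquad g(z) = \sum_{k=-n}^\infty b_k (z-z_0)^k$$ are Laurent series with complex coefficients converging in a punctured disk $0 < |z - z_0| < R$ for some $R>0$, and $|a_{-n}| \neq |b_{-n}|$. Suppose that $c = -(a_0 + \overline{b_0}) \neq 0$, and let $z_1, \ldots, z_n$ be the $n$ solutions of $$(z - z_0)^n = \frac{|a_{-n}|^2 - |b_{-n}|^2}{\overline{a_{-n}}\, c - \overline{b_{-n}}\, \overline{c}}.$$ Then for sufficiently large $|c|$: 1. There exist $n$ distinct zeros of $f$ near $z_0$. 2. The zeros in 1. are the limits of the harmonic Newton iteration for $f$ with initial points $z_1, \ldots, z_n$. Here ''for sufficiently large $|c|$'' and ''near $z_0$'' mean the following: for fixed coefficients $a_k, b_k$ with $k \neq 0$ and every $\varepsilon > 0$, there is a constant $C > 0$, depending only on $\varepsilon$ and these fixed coefficients, such that for all $a_0, b_0 \in \mathbb{C}$ with $|c| > C$ the harmonic Newton iteration for $f$ started at each $z_j$ is well defined and converges to a zero $\xi_j$ of $f$ with $|\xi_j - z_0| < \varepsilon$, and $\xi_1, \ldots, \xi_n$ are pairwise distinct.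
   Context: For a harmonic mapping $f = h + \overline{g}$ with $h, g$ analytic on an open set $\Omega \subseteq \mathbb{C}$ (that is, $f(z) = h(z) + \overline{g(z)}$), the harmonic Newton iteration with initial point $\zeta_0 \in \Omega$ is the sequence $$\zeta_{k+1} = \zeta_k - \frac{\overline{h'(\zeta_k)}\, f(\zeta_k) - \overline{g'(\zeta_k)\, f(\zeta_k)}}{|h'(\zeta_k)|^2 - |g'(\zeta_k)|^2}, \qquad k \ge 0.$$ It is well defined if every iterate lies in $\Omega$ and satisfies $|h'(\zeta_k)|^2 \neq |g'(\zeta_k)|^2$. In this statement $\Omega$ is the punctured disk $0 < |z-z_0| < R$. One of $a_{-n}$, $b_{-n}$ is allowed to be zero. *)

(* Defs.v *)
From Stdlib Require Import Reals ZArith.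
From Coquelicot Require Import Coquelicot.

Local Open Scope C_scope.

Definition CpowZ (w : C) (k : Z) : C :=
  match k with
  | Z0 => 1
  | Zpos p => w ^ Pos.to_nat p
  | Zneg p => / (w ^ Pos.to_nat p)
  end.

Definition punctured_disk (z0 : C) (r : R) (z : C) : Prop :=
  (0 < Cmod (z - z0) < r)%R.

(** [l] is the sum at [z] of the Laurent series of [a] about [z0] whose lowest
    exponent is [-n]; the [m]-th term of the series has exponent [m - n]. *)
Definition is_laurent (n : nat) (a : Z -> C) (z0 z l : C) : Prop :=
  is_series
    (fun m : nat =>
       a (Z.of_nat m - Z.of_nat n)%Z * CpowZ (z - z0) (Z.of_nat m - Z.of_nat n)%Z)
    l.

(** The coefficient family [a] with its constant coefficient replaced. *)
Definition with_coeff0 (a : Z -> C) (a0 : C) (k : Z) : C :=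
  if Z.eqb k 0 then a0 else a k.

Definition harmonic (h g : C -> C) (z : C) : C := h z + Cconj (g z).

Definition newton_denom (h g : C -> C) (z : C) : R :=
  (Cmod (C_derive h z) ^ 2 - Cmod (C_derive g z) ^ 2)%R.

(** [C_derive] is total: it is the complex derivative at the points where the
    function is complex differentiable ([is_C_derive_unique]), and meaningless
    elsewhere. *)
Definition newton_step (h g : C -> C) (z : C) : C :=
  z - (Cconj (C_derive h z) * harmonic h g z
       - Cconj (C_derive g z * harmonic h g z))
      / RtoC (newton_denom h g z).

Fixpoint newton (h g : C -> C) (zeta0 : C) (k : nat) : C :=
  match k with
  | O => zeta0
  | S k' => newton_step h g (newton h g zeta0 k')
  end.

(** [newton] is a total sequence; this says that it is the genuine iteration,
    with every iterate in [Omega] and no division by zero. *)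
Definition newton_well_defined
    (Omega : C -> Prop) (h g : C -> C) (zeta0 : C) : Prop :=
  forall k : nat,
    Omega (newton h g zeta0 k) /\ newton_denom h g (newton h g zeta0 k) <> 0%R.

(** [zs 0, ..., zs (n-1)] are pairwise distinct and are all the points
    satisfying [P]; the values of [zs] from index [n] on are irrelevant. *)
Definition enumerates (n : nat) (P : C -> Prop) (zs : nat -> C) : Prop :=
  (forall i j : nat, (i < n)%nat -> (j < n)%nat -> zs i = zs j -> i = j) /\
  (forall z : C, P z <-> exists j : nat, (j < n)%nat /\ zs j = z).

(* Main.v *)
Require Import Defs.
From Stdlib Require Import Reals ZArith Lra Lia Classical ClassicalEpsilon.
From Coquelicot Require Import Coquelicot.

(** Put [w = z - z0].  With [al = a (-n)] and [be = b (-n)] the function is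
    [f = al * w^-n + conj (be * w^-n) - c + O(|w|^(1-n))], and the initial points
    are exactly the zeros of this expression with the error term dropped: there
    [al * u + conj (be * u) = c] is a real-linear equation for [u = w^-n], which
    is invertible because [|al| <> |be|].

    Let [s = |w|] at an initial point; it is the same for all of them, and
    [s -> 0] as [|c| -> oo].  On the disk of radius [s/2] about the point, [h']
    and [g'] are [-n * al * x^(-n-1)] and [-n * be * x^(-n-1)] up to [O(s^-n)], so
    [||h'| - |g'|| >= mu] with [mu] of order [s^(-n-1)], and the
    first-order Taylor remainders of [h] and [g] are at most [K * |y - x|^2] with
    [K] of order [s^(-n-2)].  A Newton increment [D] at [x] satisfies [|D| <= |f x| / mu],
    and it cancels the affine part of [f], so the next value of [f] is at most
    [2 * K * |D|^2].  Since [|f| = O(s^(1-n))] at the start, the first increment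
    is at most [eta = O(s^2)] and [K * eta / mu = O(s)]: for small [s] the
    increments at least halve at every step, and the iteration stays in the disk and
    converges, within [2 * eta], to a zero ([newton_converges],
    [newton_near_pole]).  Two distinct initial points are at distance at least
    [s / n] ([Cpow_roots_separated]), which exceeds [4 * eta]; hence the limits are
    distinct.

    All estimates come from quadratic remainder bounds between pairs of points:
    [Cpow_taylor] for powers, summed in [power_series_taylor] and transported
    to negative powers and products in [Cinv_pow_taylor] and
    [polar_part_taylor].  Such a bound also yields complex differentiability
    ([C_derive_of_taylor]).  The threshold on [|c|] must be independent of
    [a 0] and [b 0]; this is why they are split off from the Laurent series in
    [laurent_tame_expansion] and enter only through [c]. *)

Local Open Scope C_scope.

(** * Remainder estimates for powers *)

Lemma Cpow_lipschitz (n : nat) (x y : C) (M : R) :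
  (Cmod x <= M)%R -> (Cmod y <= M)%R ->
  (Cmod (y ^ n - x ^ n) * M <= INR n * M ^ n * Cmod (y - x))%R.
Proof.
  intros Hx Hy.
  assert (HM : (0 <= M)%R) by (pose proof (Cmod_ge_0 x); lra).
  induction n as [|n IH].
  - simpl. replace (1 - 1) with (RtoC 0) by ring. rewrite Cmod_0. lra.
  - replace (y ^ S n - x ^ S n) with (y * (y ^ n - x ^ n) + (y - x) * x ^ n)
      by (rewrite !Cpow_S; ring).
    pose proof (Cmod_triangle (y * (y ^ n - x ^ n)) ((y - x) * x ^ n)) as Ht.
    rewrite !Cmod_mult, Cmod_pow in Ht.
    pose proof (pow_incr (Cmod x) M n (conj (Cmod_ge_0 x) Hx)) as Hp.
    pose proof (Cmod_ge_0 (y ^ n - x ^ n)). pose proof (Cmod_ge_0 (y - x)).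
    pose proof (Cmod_ge_0 y).
    rewrite S_INR. simpl pow.
    apply Rle_trans with
      ((Cmod y * Cmod (y ^ n - x ^ n) + Cmod (y - x) * Cmod x ^ n) * M)%R.
    { apply Rmult_le_compat_r; assumption. }
    assert ((Cmod y * (Cmod (y ^ n - x ^ n) * M)
      <= M * (INR n * M ^ n * Cmod (y - x)))%R).
    { apply Rmult_le_compat; try assumption. apply Rmult_le_pos; assumption. }
    assert ((Cmod (y - x) * Cmod x ^ n <= Cmod (y - x) * M ^ n)%R).
    { apply Rmult_le_compat_l; assumption. }
    nra.
Qed.

(** With [D n] the remainder, [D (n+1) = x * D n + (y - x) * (y^n - x^n)].
    The factor [M^2] on the left, in place of [M^(n-2)] on the right, keeps the
    bound meaningful for [n < 2]. *)
Lemma Cpow_taylor (n : nat) (x y : C) (M : R) :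
  (Cmod x <= M)%R -> (Cmod y <= M)%R ->
  (Cmod (y ^ n - x ^ n - INR n * x ^ pred n * (y - x)) * M ^ 2
   <= INR n ^ 2 * M ^ n * Cmod (y - x) ^ 2)%R.
Proof.
  intros Hx Hy.
  assert (HM : (0 <= M)%R) by (pose proof (Cmod_ge_0 x); lra).
  induction n as [|n IH].
  - simpl. replace (1 - 1 - 0 * 1 * (y - x)) with (RtoC 0) by ring.
    rewrite Cmod_0. lra.
  - set (D := y ^ n - x ^ n - INR n * x ^ pred n * (y - x)) in IH.
    assert (E : y ^ S n - x ^ S n - INR (S n) * x ^ pred (S n) * (y - x)
              = x * D + (y - x) * (y ^ n - x ^ n)).
    { unfold D. rewrite S_INR, RtoC_plus. simpl pred.
      destruct n as [|n]; simpl pred; rewrite ?Cpow_S; simpl; ring. }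
    rewrite E.
    pose proof (Cmod_triangle (x * D) ((y - x) * (y ^ n - x ^ n))) as Ht.
    rewrite !Cmod_mult in Ht.
    pose proof (Cpow_lipschitz n x y M Hx Hy) as HL.
    pose proof (Cmod_ge_0 D). pose proof (Cmod_ge_0 (y - x)).
    pose proof (Cmod_ge_0 x). pose proof (Cmod_ge_0 (y ^ n - x ^ n)).
    pose proof (pow_le M n HM). pose proof (pos_INR n).
    rewrite S_INR.
    apply Rle_trans with ((Cmod x * Cmod D
      + Cmod (y - x) * Cmod (y ^ n - x ^ n)) * M ^ 2)%R.
    { apply Rmult_le_compat_r; [nra | assumption]. }
    assert ((Cmod x * (Cmod D * M ^ 2)
      <= M * (INR n ^ 2 * M ^ n * Cmod (y - x) ^ 2))%R).
    { apply Rmult_le_compat; try assumption. apply Rmult_le_pos; nra. }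
    assert ((Cmod (y - x) * M * (Cmod (y ^ n - x ^ n) * M)
      <= Cmod (y - x) * M * (INR n * M ^ n * Cmod (y - x)))%R).
    { apply Rmult_le_compat_l; [apply Rmult_le_pos|]; assumption. }
    assert (0 <= M ^ n * M * Cmod (y - x) ^ 2)%R.
    { apply Rmult_le_pos; [apply Rmult_le_pos|apply pow2_ge_0]; assumption. }
    simpl (M ^ S n)%R. nra.
Qed.
(** * Series of complex numbers and power series *)

Lemma is_series_Cminus (u v : nat -> C) (l k : C) :
  is_series u l -> is_series v k -> is_series (fun m => u m - v m) (l - k).
Proof.
  exact (is_series_minus (V := C_NormedModule) u v l k).
Qed.

Lemma is_series_Cscal (c : C) (u : nat -> C) (l : C) :
  is_series u l -> is_series (fun m => c * u m) (c * l).
Proof.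
  exact (is_series_scal (V := C_NormedModule) c u l).
Qed.

Lemma is_series_single (k : nat) (t : C) :
  is_series (fun m : nat => if Nat.eqb m k then t else RtoC 0) t.
Proof.
  apply filterlim_ext_loc with (fun _ : nat => t); [|apply filterlim_const].
  exists k. intros m Hm. symmetry.
  induction m as [|m IH].
  - rewrite sum_O. replace k with 0%nat by lia. reflexivity.
  - rewrite sum_Sn. destruct (Nat.eqb_spec (S m) k) as [E|E].
    + assert (Z : sum_n (fun m0 : nat => if Nat.eqb m0 k then t else RtoC 0) m
                  = zero).
      { assert (Hle : (m < k)%nat) by lia. clear - Hle.
        induction m as [|m IH].
        - rewrite sum_O. destruct (Nat.eqb_spec 0 k); [lia|reflexivity].
        - rewrite sum_Sn, IH by lia. destruct (Nat.eqb_spec (S m) k); [lia|].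
          apply plus_zero_l. }
      etransitivity; [apply (f_equal2 plus Z eq_refl)|apply plus_zero_l].
    + rewrite IH by lia. exact (Cplus_0_r t).
Qed.

Lemma is_series_term_bounded (u : nat -> C) (l : C) :
  is_series u l -> exists B : R, forall m : nat, (Cmod (u m) <= B)%R.
Proof.
  intros H.
  assert (Hl : eventually (fun m => ball_norm l 1 (sum_n u m))).
  { apply (proj1 (filterlim_locally_ball_norm (sum_n u) l) H (mkposreal 1 Rlt_0_1)). }
  destruct Hl as [N HN].
  assert (Hfin : forall k, exists B : R,
            forall m, (m < k)%nat -> (Cmod (u m) <= B)%R).
  { induction k as [|k [B HB]].
    - exists 0%R. intros; lia.
    - exists (Rmax B (Cmod (u k))). intros m Hm.
      destruct (Nat.eq_dec m k) as [->|E]; [apply Rmax_r|].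
      eapply Rle_trans; [apply HB; lia|apply Rmax_l]. }
  destruct (Hfin (S N)) as [B HB].
  exists (Rmax B 2). intros m.
  destruct (le_lt_dec m N) as [E|E].
  - eapply Rle_trans; [apply HB; lia|apply Rmax_l].
  - apply Rle_trans with 2%R; [|apply Rmax_r].
    destruct m as [|m]; [lia|].
    pose proof (HN (S m) ltac:(lia)) as H1. pose proof (HN m ltac:(lia)) as H2.
    unfold ball_norm in H1, H2. rewrite sum_Sn in H1.
    change (Cmod (sum_n u m + u (S m) - l) < 1)%R in H1.
    change (Cmod (sum_n u m - l) < 1)%R in H2.
    pose proof (Cmod_triangle (sum_n u m + u (S m) - l) (- (sum_n u m - l))) as Ht.
    rewrite Cmod_opp in Ht.
    replace (sum_n u m + u (S m) - l + - (sum_n u m - l)) with (u (S m)) in Ht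
      by ring.
    lra.
Qed.

Lemma is_series_half_pow (D : R) : is_series (fun m : nat => (D * (/ 2) ^ m)%R) (2 * D)%R.
Proof.
  replace (2 * D)%R with (scal D (/ (1 - / 2)))%R.
  - apply (is_series_scal D (fun m : nat => ((/ 2) ^ m)%R)).
    apply is_series_geom. rewrite Rabs_right; lra.
  - unfold scal; simpl; unfold mult; simpl. lra.
Qed.

(** All series below are compared with one geometric series of ratio 1/2,
    which bounds the sum explicitly. *)
Lemma is_series_Cmod_le (u : nat -> C) (l : C) (D : R) :
  is_series u l -> (forall m, (Cmod (u m) <= D * (/ 2) ^ m)%R) ->
  (Cmod l <= 2 * D)%R.
Proof.
  intros Hu Hb.
  assert (H1 : is_lim_seq (fun m => norm (sum_n u m)) (Cmod l)).
  { apply (filterlim_comp nat C R (sum_n u) norm eventually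
             (locally (l : C_NormedModule)) (locally (Cmod l))).
    - exact Hu.
    - apply (filterlim_norm (V := C_NormedModule) l). }
  assert (H2 : is_lim_seq (sum_n (fun m : nat => (D * (/ 2) ^ m)%R)) (2 * D)%R)
    by apply is_series_half_pow.
  apply (is_lim_seq_le _ _ (Cmod l) (2 * D)%R) with (2 := H1) (3 := H2).
  intros m. eapply Rle_trans; [apply (norm_sum_n_m (V := C_NormedModule) u 0 m)|].
  apply sum_n_m_le. exact Hb.
Qed.

Lemma ex_series_half_pow (u : nat -> C) (D : R) :
  (forall m, (Cmod (u m) <= D * (/ 2) ^ m)%R) -> exists l : C, is_series u l.
Proof.
  intros Hb.
  apply (@ex_series_le C_AbsRing C_CompleteNormedModule u
           (fun m => (D * (/ 2) ^ m)%R) Hb).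
  eexists. apply is_series_half_pow.
Qed.

(** On a disk eight times smaller than where the coefficients are controlled,
    this turns the factor [m^2] of [Cpow_taylor] into the ratio 4/8. *)
Lemma INR_sqr_le_pow4 (m : nat) : (INR m ^ 2 <= 4 ^ m)%R.
Proof.
  assert (H : (INR m <= 2 ^ m)%R).
  { induction m as [|m IH]; [simpl; lra|].
    rewrite S_INR. simpl. pose proof (pow_R1_Rle 2 m ltac:(lra)). lra. }
  replace 4%R with (2 * 2)%R by ring. rewrite Rpow_mult_distr.
  pose proof (pos_INR m). nra.
Qed.

Definition Csum (u : nat -> C) : C :=
  epsilon (inhabits (RtoC 0)) (fun l : C => is_series u l).

Lemma Csum_correct (u : nat -> C) (D : R) :
  (forall m, (Cmod (u m) <= D * (/ 2) ^ m)%R) -> is_series u (Csum u).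
Proof.
  intros H. unfold Csum. apply epsilon_spec. exact (ex_series_half_pow u D H).
Qed.

(** Termwise application of [Cpow_taylor] gives the quadratic remainder of the
    sum directly, with no theorem on differentiation of series. *)
Lemma power_series_taylor (alpha : nat -> C) (B rho : R) :
  (0 < rho)%R -> (forall m, (Cmod (alpha m) * rho ^ m <= B)%R) ->
  exists (L : R) (A dA : C -> C), (0 < L)%R /\
    forall x, (Cmod x <= rho / 8)%R ->
      is_series (fun m : nat => alpha m * x ^ m) (A x) /\
      (Cmod (A x) <= L)%R /\ (Cmod (dA x) <= L)%R /\
      (Cmod (A x - alpha 0%nat) <= L * Cmod x)%R /\
      forall y, (Cmod y <= rho / 8)%R ->
        (Cmod (A y - A x - dA x * (y - x)) <= L * Cmod (y - x) ^ 2)%R.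
Proof.
  intros Hrho Halpha.
  set (M := (rho / 8)%R).
  assert (HM : (0 < M)%R) by (unfold M; lra).
  assert (HB : (0 <= B)%R).
  { pose proof (Halpha 0%nat). pose proof (Cmod_ge_0 (alpha 0%nat)).
    simpl in *. lra. }
  (* The term of index [m] and, below, those of the derivative and of the
     remainder are all dominated by this weight. *)
  assert (Hw : forall m, (INR m ^ 2 * (Cmod (alpha m) * M ^ m) <= B * (/ 2) ^ m)%R).
  { intros m.
    pose proof (INR_sqr_le_pow4 m) as H4. pose proof (Halpha m) as Ha.
    assert (E : (M ^ m = rho ^ m * (/ 8) ^ m)%R).
    { unfold M, Rdiv. apply Rpow_mult_distr. }
    (* 1/2 = 4 * (1/8): the growth [4^m] of [m^2] is absorbed here. *)
    assert (E2 : ((/ 2) ^ m = 4 ^ m * (/ 8) ^ m)%R).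
    { rewrite <- Rpow_mult_distr. f_equal. lra. }
    rewrite E, E2.
    pose proof (pow_lt (/ 8) m ltac:(lra)).
    replace (INR m ^ 2 * (Cmod (alpha m) * (rho ^ m * (/ 8) ^ m)))%R
      with (INR m ^ 2 * (Cmod (alpha m) * rho ^ m) * (/ 8) ^ m)%R by ring.
    replace (B * (4 ^ m * (/ 8) ^ m))%R with (4 ^ m * B * (/ 8) ^ m)%R by ring.
    apply Rmult_le_compat_r; [lra|].
    apply Rmult_le_compat; try assumption; [apply pow2_ge_0|].
    apply Rmult_le_pos; [apply Cmod_ge_0|apply pow_le; lra]. }
  assert (Hw1 : forall m, (INR m * (Cmod (alpha m) * M ^ m) <= B * (/ 2) ^ m)%R).
  { intros m. eapply Rle_trans; [|apply Hw]. apply Rmult_le_compat_r.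
    - apply Rmult_le_pos; [apply Cmod_ge_0|apply pow_le; lra].
    - destruct m as [|m]; [simpl; lra|].
      pose proof (pos_INR m). rewrite S_INR. nra. }
  assert (Hw0 : forall m, (Cmod (alpha m) * M ^ m <= B * (/ 2) ^ m)%R).
  { intros [|m].
    - pose proof (Halpha 0%nat). simpl in *. lra.
    - eapply Rle_trans; [|apply (Hw1 (S m))].
      assert (0 <= Cmod (alpha (S m)) * M ^ S m)%R
        by (apply Rmult_le_pos; [apply Cmod_ge_0|apply pow_le; lra]).
      pose proof (pos_INR m). rewrite S_INR. nra. }
  assert (HT : forall x, (Cmod x <= M)%R ->
            forall m, (Cmod (alpha m * x ^ m) <= B * (/ 2) ^ m)%R).
  { intros x Hx m. eapply Rle_trans; [|apply Hw0].
    rewrite Cmod_mult, Cmod_pow. apply Rmult_le_compat_l; [apply Cmod_ge_0|].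
    apply pow_incr. split; [apply Cmod_ge_0|exact Hx]. }
  assert (HdT : forall x, (Cmod x <= M)%R -> forall m,
            (Cmod (alpha m * (INR m * x ^ pred m)) <= B / M * (/ 2) ^ m)%R).
  { intros x Hx m.
    apply Rmult_le_reg_r with M; [exact HM|].
    replace (B / M * (/ 2) ^ m * M)%R with (B * (/ 2) ^ m)%R by (field; lra).
    eapply Rle_trans; [|apply Hw1].
    rewrite !Cmod_mult, Cmod_pow, Cmod_R, (Rabs_right (INR m))
      by (apply Rle_ge, pos_INR).
    destruct m as [|m]; [simpl; lra|]. simpl pred.
    assert (Hp : (Cmod x ^ m <= M ^ m)%R)
      by (apply pow_incr; split; [apply Cmod_ge_0|exact Hx]).
    replace (INR (S m) * (Cmod (alpha (S m)) * M ^ S m))%R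
      with (Cmod (alpha (S m)) * (INR (S m) * M ^ m) * M)%R by (simpl pow; ring).
    apply Rmult_le_compat_r; [lra|].
    apply Rmult_le_compat_l; [apply Cmod_ge_0|].
    apply Rmult_le_compat_l; [apply pos_INR|exact Hp]. }
  set (A := fun x => Csum (fun m => alpha m * x ^ m)).
  set (dA := fun x => Csum (fun m => alpha m * (INR m * x ^ pred m))).
  assert (HA : forall x, (Cmod x <= M)%R ->
            is_series (fun m => alpha m * x ^ m) (A x)).
  { intros x Hx. apply (Csum_correct _ B). apply HT, Hx. }
  assert (HdA : forall x, (Cmod x <= M)%R ->
            is_series (fun m => alpha m * (INR m * x ^ pred m)) (dA x)).
  { intros x Hx. apply (Csum_correct _ (B / M)). apply HdT, Hx. }
  assert (HTay : forall x y, (Cmod x <= M)%R -> (Cmod y <= M)%R ->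
    (Cmod (A y - A x - dA x * (y - x)) <= 2 * B / M ^ 2 * Cmod (y - x) ^ 2)%R).
  { intros x y Hx Hy.
    assert (HS : is_series (fun m => alpha m *
                  (y ^ m - x ^ m - INR m * x ^ pred m * (y - x)))
                  (A y - A x - dA x * (y - x))).
    { apply is_series_ext with (fun m =>
        alpha m * y ^ m - alpha m * x ^ m
        - (y - x) * (alpha m * (INR m * x ^ pred m))).
      - intros m. match goal with |- ?x = ?y => change (@eq C x y) end. ring.
      - replace (A y - A x - dA x * (y - x))
          with (A y - A x - (y - x) * dA x) by ring.
        apply is_series_Cminus; [apply is_series_Cminus; auto|].
        apply is_series_Cscal; auto. }
    replace (2 * B / M ^ 2 * Cmod (y - x) ^ 2)%R
      with (2 * (B / M ^ 2 * Cmod (y - x) ^ 2))%R by (unfold Rdiv; ring).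
    apply (is_series_Cmod_le _ _ _ HS). intros m.
    apply Rmult_le_reg_r with (M ^ 2)%R; [apply pow_lt; lra|].
    replace (B / M ^ 2 * Cmod (y - x) ^ 2 * (/ 2) ^ m * M ^ 2)%R
      with (B * (/ 2) ^ m * Cmod (y - x) ^ 2)%R by (field; lra).
    rewrite Cmod_mult, Rmult_assoc.
    eapply Rle_trans.
    { apply Rmult_le_compat_l; [apply Cmod_ge_0|].
      apply (Cpow_taylor m x y M Hx Hy). }
    replace (Cmod (alpha m) * (INR m ^ 2 * M ^ m * Cmod (y - x) ^ 2))%R
      with (INR m ^ 2 * (Cmod (alpha m) * M ^ m) * Cmod (y - x) ^ 2)%R by ring.
    apply Rmult_le_compat_r; [apply pow2_ge_0|apply Hw]. }
  assert (HA0 : A 0 = alpha 0%nat).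
  { apply (filterlim_locally_unique (V := C_NormedModule) (F := eventually)
      (sum_n (fun m => alpha m * RtoC 0 ^ m)) (A 0) (alpha 0%nat)).
    - apply HA. rewrite Cmod_0. lra.
    - apply is_series_ext with (fun m => if Nat.eqb m 0 then alpha 0%nat else RtoC 0).
      + intros [|m]; simpl; ring.
      + apply is_series_single. }
  assert (Hq1 : (0 <= B / M)%R) by (apply Rdiv_le_0_compat; lra).
  assert (Hq2 : (0 <= B / M ^ 2)%R)
    by (apply Rdiv_le_0_compat; [lra|apply pow_lt; lra]).
  (* [2 * B], [2 * (B / M)] and [2 * (B / M ^ 2)] bound the value, the
     derivative and the remainder; the Lipschitz bound at 0 uses the
     derivative and the remainder together, and 1 makes the constant positive. *)
  exists (1 + 2 * B + 4 * (B / M) + 2 * (B / M ^ 2))%R, A, dA.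
  split; [lra|].
  intros x Hx. fold M in Hx |- *.
  pose proof (is_series_Cmod_le _ _ _ (HA x Hx) (HT x Hx)) as HAb.
  assert (HdAb : forall x, (Cmod x <= M)%R -> (Cmod (dA x) <= 2 * (B / M))%R).
  { intros x' Hx'. apply (is_series_Cmod_le _ _ _ (HdA x' Hx') (HdT x' Hx')). }
  split; [auto|]. split; [lra|]. split; [pose proof (HdAb x Hx); lra|].
  split.
  - assert (H0 : (Cmod 0 <= M)%R) by (rewrite Cmod_0; lra).
    pose proof (HTay 0 x H0 Hx) as Ht. pose proof (HdAb 0 H0) as Hd.
    rewrite HA0 in Ht. replace (x - 0) with x in Ht by ring.
    pose proof (Cmod_triangle (A x - alpha 0%nat - dA 0 * x) (dA 0 * x)) as Htr.
    replace (A x - alpha 0%nat - dA 0 * x + dA 0 * x) with (A x - alpha 0%nat)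
      in Htr by ring.
    rewrite Cmod_mult in Htr. pose proof (Cmod_ge_0 x).
    assert (2 * B / M ^ 2 * Cmod x ^ 2 <= 2 * (B / M) * Cmod x)%R.
    { replace (2 * (B / M) * Cmod x)%R with (2 * B / M ^ 2 * (M * Cmod x))%R
        by (field; lra).
      apply Rmult_le_compat_l; [unfold Rdiv in *; lra|]. nra. }
    nra.
  - intros y Hy. eapply Rle_trans; [apply HTay; assumption|].
    apply Rmult_le_compat_r; [apply pow2_ge_0|]. unfold Rdiv in *. lra.
Qed.
(** * Convergence of the harmonic Newton iteration *)

Lemma C_derive_of_taylor (f : C -> C) (x d : C) (K delta : R) :
  (0 < delta)%R ->
  (forall y, (Cmod (y - x) < delta)%R ->
     (Cmod (f y - f x - d * (y - x)) <= K * Cmod (y - x) ^ 2)%R) ->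
  C_derive f x = d.
Proof.
  intros Hdelta H.
  apply is_C_lim_unique.
  apply (filterlim_locally_ball_norm (U := C_NormedModule)
           (fun y : C => (f y - f x) / (y - x)) d).
  intros eps.
  assert (HK : (0 < Rabs K + 1)%R) by (pose proof (Rabs_pos K); lra).
  assert (Hr : (0 < Rmin delta (eps / (Rabs K + 1)))%R).
  { apply Rmin_glb_lt; [exact Hdelta|].
    apply Rdiv_lt_0_compat; [apply cond_pos|exact HK]. }
  unfold locally', within.
  apply (filter_imp (ball_norm (V := C_NormedModule) x (mkposreal _ Hr)));
    [|apply (locally_ball_norm (V := C_NormedModule))].
  intros y Hy Hne.
  change (Cmod (y - x) < Rmin delta (eps / (Rabs K + 1)))%R in Hy.
  change (Cmod ((f y - f x) / (y - x) - d) < eps)%R.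
  assert (Hn0 : y - x <> 0) by (intros E; apply Hne, Ceq_minus, E).
  replace ((f y - f x) / (y - x) - d)
    with ((f y - f x - d * (y - x)) / (y - x)) by (field; exact Hn0).
  rewrite Cmod_div by exact Hn0.
  pose proof (proj1 (Cmod_gt_0 _) Hn0) as Hpos.
  pose proof (Rmin_l delta (eps / (Rabs K + 1))).
  pose proof (Rmin_r delta (eps / (Rabs K + 1))).
  pose proof (H y ltac:(lra)) as Hb.
  apply Rle_lt_trans with (K * Cmod (y - x))%R.
  - apply Rmult_le_reg_r with (Cmod (y - x)); [exact Hpos|].
    unfold Rdiv. rewrite Rmult_assoc, Rinv_l by lra. nra.
  - assert (Hlt : (Cmod (y - x) < eps / (Rabs K + 1))%R) by lra.
    apply (Rmult_lt_compat_r (Rabs K + 1) _ _ HK) in Hlt.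
    replace (eps / (Rabs K + 1) * (Rabs K + 1))%R with (pos eps) in Hlt
      by (field; lra).
    pose proof (Rle_abs K). nra.
Qed.

Lemma Cmod_sub_triangle (x y z : C) :
  (Cmod (x - z) <= Cmod (x - y) + Cmod (y - z))%R.
Proof.
  replace (x - z) with ((x - y) + (y - z)) by ring. apply Cmod_triangle.
Qed.

Lemma Cmod_sub_sym (x y : C) : Cmod (x - y) = Cmod (y - x).
Proof. rewrite <- Cmod_opp. f_equal. ring. Qed.

(** The formula for the step is Cramer's rule for the real-linear equation
    [f + h' D + conj (g' D) = 0]. *)
Lemma newton_increment_solves (h g : C -> C) (z : C) :
  newton_denom h g z <> 0%R ->
  let D := newton_step h g z - z in
  harmonic h g z + C_derive h z * D + Cconj (C_derive g z * D) = 0.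
Proof.
  intros Hd D.
  set (p := C_derive h z). set (q := C_derive g z).
  set (f := harmonic h g z).
  assert (HD : RtoC (newton_denom h g z) = p * Cconj p - q * Cconj q).
  { unfold newton_denom. rewrite RtoC_minus, !Cmod2_conj. reflexivity. }
  assert (Hd' : p * Cconj p - q * Cconj q <> 0).
  { rewrite <- HD. intros E. apply Hd, RtoC_inj, E. }
  assert (ED : D = - (Cconj p * f - Cconj (q * f)) / (p * Cconj p - q * Cconj q)).
  { unfold D, newton_step. fold p q f. rewrite HD. field. exact Hd'. }
  assert (Hd2 : Cconj p * p - Cconj q * q <> 0).
  { intros E. apply Hd'. rewrite <- E. ring. }
  rewrite ED, !Cmult_conj, Cdiv_conj by exact Hd'.
  rewrite Copp_conj, !Cminus_conj, !Cmult_conj, !Cconj_conj.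
  field. exact Hd2.
Qed.

(** The real-linear map [D |-> h' D + conj (g' D)] expands lengths by at least
    [||h'| - |g'||]. *)
Lemma newton_increment_bound (h g : C -> C) (z : C) (mu : R) :
  (0 < mu)%R ->
  (mu <= Rabs (Cmod (C_derive h z) - Cmod (C_derive g z)))%R ->
  newton_denom h g z <> 0%R /\
  (mu * Cmod (newton_step h g z - z) <= Cmod (harmonic h g z))%R.
Proof.
  intros Hmu Hle.
  assert (Hd : newton_denom h g z <> 0%R).
  { unfold newton_denom. intros E.
    replace (Cmod (C_derive h z)) with (Cmod (C_derive g z)) in Hle.
    - rewrite Rminus_diag, Rabs_R0 in Hle. lra.
    - pose proof (Cmod_ge_0 (C_derive h z)). pose proof (Cmod_ge_0 (C_derive g z)).
      nra. }
  split; [exact Hd|].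
  pose proof (newton_increment_solves h g z Hd) as E. cbv zeta in E.
  set (D := newton_step h g z - z) in *.
  set (p := C_derive h z) in *. set (q := C_derive g z) in *.
  assert (Hf : Cmod (harmonic h g z) = Cmod (p * D + Cconj (q * D))).
  { rewrite <- Cmod_opp. f_equal.
    replace (- harmonic h g z) with
      (p * D + Cconj (q * D) - (harmonic h g z + p * D + Cconj (q * D))) by ring.
    rewrite E. ring. }
  rewrite Hf.
  pose proof (Cmod_triangle (p * D + Cconj (q * D)) (- Cconj (q * D))) as T1.
  pose proof (Cmod_triangle (p * D + Cconj (q * D)) (- (p * D))) as T2.
  replace (p * D + Cconj (q * D) + - Cconj (q * D)) with (p * D) in T1 by ring.
  replace (p * D + Cconj (q * D) + - (p * D)) with (Cconj (q * D)) in T2 by ring.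
  rewrite Cmod_opp, ?Cmod_conj, !Cmod_mult in T1.
  rewrite Cmod_opp, ?Cmod_conj, !Cmod_mult in T2.
  pose proof (Cmod_ge_0 D).
  unfold Rabs in Hle. destruct (Rcase_abs (Cmod p - Cmod q)); nra.
Qed.

(** A Newton-Kantorovich argument in which the lower bound [mu] holds on the
    whole disk.  After an increment of length [e] the value of [f] is at most
    [2 * K * e^2 <= mu * e / 2] as long as [e <= eta], so the increments are
    bounded by [eta / 2^k] and add up to at most [2 * eta]. *)
Lemma newton_converges (h g dh dg : C -> C) (z : C) (rad K mu eta : R) :
  (0 < mu)%R -> (0 <= K)%R -> (0 <= eta)%R ->
  (forall x y, (Cmod (x - z) < rad)%R -> (Cmod (y - z) < rad)%R ->
     (Cmod (h y - h x - dh x * (y - x)) <= K * Cmod (y - x) ^ 2)%R) ->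
  (forall x y, (Cmod (x - z) < rad)%R -> (Cmod (y - z) < rad)%R ->
     (Cmod (g y - g x - dg x * (y - x)) <= K * Cmod (y - x) ^ 2)%R) ->
  (forall x, (Cmod (x - z) < rad)%R -> (mu <= Rabs (Cmod (dh x) - Cmod (dg x)))%R) ->
  (Cmod (harmonic h g z) <= mu * eta)%R ->
  (4 * K * eta <= mu)%R -> (2 * eta < rad)%R ->
  newton_well_defined (fun x => (Cmod (x - z) < rad)%R) h g z /\
  exists xi : C,
    filterlim (newton h g z) eventually (locally xi) /\
    harmonic h g xi = 0 /\ (Cmod (xi - z) <= 2 * eta)%R.
Proof.
  intros Hmu HK Heta Hh Hg Hlow H0 HKe Hrad.
  assert (Hder : forall F dF : C -> C,
    (forall x y, (Cmod (x - z) < rad)%R -> (Cmod (y - z) < rad)%R ->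
       (Cmod (F y - F x - dF x * (y - x)) <= K * Cmod (y - x) ^ 2)%R) ->
    forall x, (Cmod (x - z) < rad)%R -> C_derive F x = dF x).
  { intros F dF HF x Hx.
    apply (C_derive_of_taylor F x (dF x) K (rad - Cmod (x - z))); [lra|].
    intros y Hy. apply HF; [exact Hx|].
    pose proof (Cmod_sub_triangle y x z). lra. }
  assert (Htay : forall x y, (Cmod (x - z) < rad)%R -> (Cmod (y - z) < rad)%R ->
    (Cmod (harmonic h g y
           - (harmonic h g x + dh x * (y - x) + Cconj (dg x * (y - x))))
     <= 2 * K * Cmod (y - x) ^ 2)%R).
  { intros x y Hx Hy.
    replace (harmonic h g y
           - (harmonic h g x + dh x * (y - x) + Cconj (dg x * (y - x))))
      with ((h y - h x - dh x * (y - x)) + Cconj (g y - g x - dg x * (y - x))).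
    - eapply Rle_trans; [apply Cmod_triangle|]. rewrite Cmod_conj.
      pose proof (Hh x y Hx Hy). pose proof (Hg x y Hx Hy). lra.
    - unfold harmonic. rewrite !Cminus_conj. ring. }
  set (u := newton h g z).
  assert (Hinv : forall k,
    (Cmod (u k - z) <= 2 * eta * (1 - (/ 2) ^ k))%R /\
    (Cmod (harmonic h g (u k)) <= mu * (eta * (/ 2) ^ k))%R /\
    newton_denom h g (u k) <> 0%R /\
    (Cmod (u (S k) - u k) <= eta * (/ 2) ^ k)%R).
  { assert (Hstep : forall k,
      (Cmod (u k - z) <= 2 * eta * (1 - (/ 2) ^ k))%R ->
      (Cmod (harmonic h g (u k)) <= mu * (eta * (/ 2) ^ k))%R ->
      (Cmod (u k - z) < rad)%R /\
      newton_denom h g (u k) <> 0%R /\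
      (Cmod (u (S k) - u k) <= eta * (/ 2) ^ k)%R).
    { intros k Hk Hfk.
      pose proof (pow_lt (/ 2) k ltac:(lra)) as Hp.
      assert (Hin : (Cmod (u k - z) < rad)%R) by nra.
      split; [exact Hin|].
      destruct (newton_increment_bound h g (u k) mu Hmu) as [Hd Hb].
      { rewrite (Hder h dh Hh _ Hin), (Hder g dg Hg _ Hin). auto. }
      split; [exact Hd|].
      change (newton_step h g (u k)) with (u (S k)) in Hb.
      apply Rmult_le_reg_l with mu; lra. }
    assert (Hbase : forall k,
      (Cmod (u k - z) <= 2 * eta * (1 - (/ 2) ^ k))%R /\
      (Cmod (harmonic h g (u k)) <= mu * (eta * (/ 2) ^ k))%R).
    { induction k as [|k [Hk Hfk]].
      - change (u 0%nat) with z. simpl pow.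
        replace (z - z) with (RtoC 0) by ring. rewrite Cmod_0. lra.
      - destruct (Hstep k Hk Hfk) as (Hin & Hd & Hb).
        pose proof (pow_lt (/ 2) k ltac:(lra)) as Hp.
        pose proof (pow_incr (/ 2) 1 k ltac:(lra)) as Hp1. rewrite pow1 in Hp1.
        assert (Hk1 : (Cmod (u (S k) - z) <= 2 * eta * (1 - (/ 2) ^ S k))%R).
        { pose proof (Cmod_sub_triangle (u (S k)) (u k) z). simpl pow. nra. }
        split; [exact Hk1|].
        assert (Hin1 : (Cmod (u (S k) - z) < rad)%R).
        { pose proof (pow_lt (/ 2) (S k) ltac:(lra)). nra. }
        pose proof (Htay (u k) (u (S k)) Hin Hin1) as Ht.
        pose proof (newton_increment_solves h g (u k) Hd) as E. cbv zeta in E.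
        change (newton_step h g (u k)) with (u (S k)) in E.
        rewrite (Hder h dh Hh _ Hin), (Hder g dg Hg _ Hin) in E.
        (* By the linearised equation, [Ht] bounds the new value of [f] itself. *)
        rewrite E in Ht.
        replace (harmonic h g (u (S k)) - 0) with (harmonic h g (u (S k))) in Ht
          by ring.
        eapply Rle_trans; [exact Ht|].
        pose proof (Cmod_ge_0 (u (S k) - u k)).
        set (e := (eta * (/ 2) ^ k)%R) in *.
        assert (He : (0 <= e <= eta)%R) by (unfold e; split; nra).
        assert (Hsq : (Cmod (u (S k) - u k) ^ 2 <= eta * e)%R) by nra.
        replace (mu * (eta * (/ 2) ^ S k))%R with (mu / 2 * e)%R
          by (unfold e; simpl pow; field).
        apply Rle_trans with (2 * K * (eta * e))%R; [apply Rmult_le_compat_l; lra|].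
        nra. }
    intros k. destruct (Hbase k) as [H1 H2].
    destruct (Hstep k H1 H2) as (_ & H3 & H4). auto. }
  assert (Hin : forall k, (Cmod (u k - z) < rad)%R).
  { intros k. destruct (Hinv k) as [H1 _].
    pose proof (pow_lt (/ 2) k ltac:(lra)). nra. }
  split; [intros k; split; [apply Hin|apply (Hinv k)]|].
  destruct (ex_series_half_pow (fun k => u (S k) - u k) eta) as [l Hl];
    [intros k; apply (Hinv k)|].
  assert (Hsum : forall k, sum_n (fun k => u (S k) - u k) k = u (S k) - z).
  { induction k as [|k IH].
    - rewrite sum_O. reflexivity.
    - rewrite sum_Sn, IH. change (u (S k) - z + (u (S (S k)) - u (S k))
                                  = u (S (S k)) - z). ring. }
  exists (z + l).
  assert (Hcv : forall e : posreal, eventually (fun k => (Cmod (u k - (z + l)) < e)%R)).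
  { intros e.
    destruct (proj1 (filterlim_locally_ball_norm (U := C_NormedModule)
      (sum_n (fun k => u (S k) - u k)) l) Hl e) as [N HN].
    exists (S N). intros [|k] Hk; [lia|].
    pose proof (HN k ltac:(lia)) as Hb.
    unfold ball_norm in Hb. rewrite Hsum in Hb.
    change (Cmod (u (S k) - z - l) < e)%R in Hb.
    replace (u (S k) - (z + l)) with (u (S k) - z - l) by ring. exact Hb. }
  assert (Hxi : (Cmod (z + l - z) <= 2 * eta)%R).
  { apply le_epsilon. intros e He.
    destruct (Hcv (mkposreal e He)) as [N HN].
    specialize (HN N (le_n N)). simpl in HN.
    destruct (Hinv N) as [HN1 _].
    pose proof (pow_lt (/ 2) N ltac:(lra)).
    pose proof (Cmod_sub_triangle (z + l) (u N) z).
    rewrite Cmod_sub_sym in HN. nra. }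
  split; [|split; [|exact Hxi]].
  - apply (filterlim_locally_ball_norm (U := C_NormedModule) u (z + l)).
    exact Hcv.
  (* Continuity of [f] at the limit comes from its Taylor bound there:
     [|f xi| <= |f (u k)| + E * t + 2 * K * t^2] with [t = |u k - xi|]. *)
  - apply Cmod_eq_0. apply Rle_antisym; [|apply Cmod_ge_0].
    set (xi := z + l) in *.
    set (E := (Cmod (dh xi) + Cmod (dg xi))%R).
    assert (HE : (0 <= E)%R)
      by (unfold E; pose proof (Cmod_ge_0 (dh xi)); pose proof (Cmod_ge_0 (dg xi)); lra).
    assert (HQ : (0 <= mu * eta + E + 2 * K)%R) by nra.
    set (Q := (mu * eta + E + 2 * K)%R) in *.
    apply le_epsilon. intros e He.
    set (d := Rmin 1 (e / (Q + 1))).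
    assert (Hd : (0 < d)%R).
    { apply Rmin_glb_lt; [lra|]. apply Rdiv_lt_0_compat; lra. }
    assert (Hd1 : (d <= 1)%R) by apply Rmin_l.
    assert (Hd2 : (Q * d <= e)%R).
    { assert (d <= e / (Q + 1))%R by apply Rmin_r.
      assert ((Q + 1) * d <= (Q + 1) * (e / (Q + 1)))%R
        by (apply Rmult_le_compat_l; lra).
      replace ((Q + 1) * (e / (Q + 1)))%R with e in * by (field; lra). lra. }
    destruct (Hcv (mkposreal d Hd)) as [N1 HN1]. simpl in HN1.
    destruct (pow_lt_1_zero (/ 2) ltac:(rewrite Rabs_right; lra) d Hd) as [N2 HN2].
    set (k := max N1 N2).
    specialize (HN1 k ltac:(lia)). specialize (HN2 k ltac:(lia)).
    rewrite Rabs_right in HN2 by (apply Rle_ge, pow_le; lra).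
    destruct (Hinv k) as (_ & Hfk & _).
    pose proof (Htay xi (u k) ltac:(lra) (Hin k)) as Ht.
    set (t := Cmod (u k - xi)) in *.
    assert (Ht0 : (0 <= t)%R) by apply Cmod_ge_0.
    set (P := dh xi * (u k - xi) + Cconj (dg xi * (u k - xi))).
    assert (HP : (Cmod P <= E * t)%R).
    { unfold P, E, t. eapply Rle_trans; [apply Cmod_triangle|].
      rewrite Cmod_conj, !Cmod_mult. lra. }
    set (W := harmonic h g (u k)
      - (harmonic h g xi + dh xi * (u k - xi) + Cconj (dg xi * (u k - xi)))) in *.
    assert (Eq : harmonic h g xi = harmonic h g (u k) + - W + - P)
      by (unfold W, P; ring).
    rewrite Eq.
    pose proof (Cmod_triangle (harmonic h g (u k) + - W) (- P)) as T1.
    pose proof (Cmod_triangle (harmonic h g (u k)) (- W)) as T2.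
    rewrite Cmod_opp in T1, T2.
    assert (mu * (eta * (/ 2) ^ k) <= mu * eta * d)%R.
    { rewrite <- Rmult_assoc. apply Rmult_le_compat_l; nra. }
    assert (E * t <= E * d)%R by (apply Rmult_le_compat_l; lra).
    assert (t ^ 2 <= d)%R by nra.
    assert (2 * K * t ^ 2 <= 2 * K * d)%R by (apply Rmult_le_compat_l; lra).
    unfold Q in Hd2. lra.
Qed.
(** * Estimates near the pole *)

Lemma Cinv_pow_lipschitz (n : nat) (x y : C) (M : R) :
  x <> 0 -> y <> 0 -> (Cmod (/ x) <= M)%R -> (Cmod (/ y) <= M)%R ->
  (Cmod ((/ y) ^ n - (/ x) ^ n) <= INR n * M ^ S n * Cmod (y - x))%R.
Proof.
  intros Hx Hy HX HY.
  assert (HM : (0 < M)%R).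
  { pose proof (proj1 (Cmod_gt_0 (/ x))) as H. rewrite Cmod_inv in * by exact Hx.
    pose proof (Rinv_0_lt_compat _ (proj1 (Cmod_gt_0 x) Hx)). lra. }
  pose proof (Cpow_lipschitz n (/ x) (/ y) M HX HY) as HL.
  apply Rmult_le_reg_r with M; [exact HM|].
  eapply Rle_trans; [exact HL|].
  replace (INR n * M ^ S n * Cmod (y - x) * M)%R
    with (INR n * M ^ n * (M * M * Cmod (y - x)))%R by (simpl pow; ring).
  apply Rmult_le_compat_l.
  { apply Rmult_le_pos; [apply pos_INR|apply pow_le; lra]. }
  replace (/ y - / x) with (- (/ x * / y * (y - x))) by (field; auto).
  rewrite Cmod_opp, !Cmod_mult.
  apply Rmult_le_compat_r; [apply Cmod_ge_0|].
  apply Rmult_le_compat; auto using Cmod_ge_0.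
Qed.

(** [Cpow_taylor] at [X = 1/x] and [Y = 1/y], where [Y - X = - X Y (y - x)].
    Replacing [Y] by [X] in this product costs a further term of second order,
    [n X^(n+1) Y (y - x)^2]. *)
Lemma Cinv_pow_taylor (n : nat) (x y : C) (M : R) :
  x <> 0 -> y <> 0 -> (Cmod (/ x) <= M)%R -> (Cmod (/ y) <= M)%R ->
  (Cmod ((/ y) ^ n - (/ x) ^ n + INR n * (/ x) ^ S n * (y - x))
   <= 2 * INR n ^ 2 * M ^ (n + 2) * Cmod (y - x) ^ 2)%R.
Proof.
  intros Hx Hy HX HY.
  assert (HM : (0 < M)%R).
  { rewrite Cmod_inv in HX by exact Hx.
    pose proof (Rinv_0_lt_compat _ (proj1 (Cmod_gt_0 x) Hx)). lra. }
  set (X := / x) in *. set (Y := / y) in *.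
  assert (EYX : Y - X = - (X * Y * (y - x))) by (unfold X, Y; field; auto).
  assert (E : Y ^ n - X ^ n + INR n * X ^ S n * (y - x)
    = (Y ^ n - X ^ n - INR n * X ^ pred n * (Y - X))
      + INR n * (X ^ pred n * (X * X * Y * ((y - x) * (y - x))))).
  { destruct n as [|n].
    - simpl INR. simpl Cpow. ring.
    - simpl pred. rewrite (Cpow_S X (S n)), (Cpow_S X n).
      replace (INR (S n) * X ^ n * (Y - X))
        with (INR (S n) * X ^ n * - (X * Y * (y - x))) by (rewrite EYX; reflexivity).
      assert (E1 : X * X * Y * ((y - x) * (y - x))
                   = X * (y - x) * (X - Y)).
      { replace (X - Y) with (X * Y * (y - x)); [ring|].
        replace (X - Y) with (- (Y - X)) by ring. rewrite EYX. ring. }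
      rewrite E1.
      replace (X * (y - x) * (X - Y)) with (X * X * (y - x) - X * Y * (y - x)) by ring.
      ring. }
  rewrite E. clear E.
  pose proof (Cpow_taylor n X Y M HX HY) as HT.
  set (D := Y ^ n - X ^ n - INR n * X ^ pred n * (Y - X)) in *.
  assert (Hd : (Cmod (Y - X) <= M * M * Cmod (y - x))%R).
  { rewrite EYX, Cmod_opp, !Cmod_mult.
    apply Rmult_le_compat_r; [apply Cmod_ge_0|].
    apply Rmult_le_compat; auto using Cmod_ge_0. }
  set (d := Cmod (y - x)) in *.
  assert (Hd0 : (0 <= d)%R) by apply Cmod_ge_0.
  assert (HMn : (0 < M ^ n)%R) by (apply pow_lt, HM).
  assert (HD : (Cmod D <= INR n ^ 2 * M ^ (n + 2) * d ^ 2)%R).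
  { apply Rmult_le_reg_r with (M ^ 2)%R; [apply pow_lt, HM|].
    eapply Rle_trans; [exact HT|].
    replace (INR n ^ 2 * M ^ (n + 2) * d ^ 2 * M ^ 2)%R
      with (INR n ^ 2 * M ^ n * (M * M * d) ^ 2)%R by (rewrite pow_add; ring).
    apply Rmult_le_compat_l.
    - apply Rmult_le_pos; [apply pow2_ge_0|lra].
    - apply pow_incr. split; [apply Cmod_ge_0|exact Hd]. }
  assert (HR : (Cmod (INR n * (X ^ pred n * (X * X * Y * ((y - x) * (y - x)))))
                <= INR n ^ 2 * M ^ (n + 2) * d ^ 2)%R).
  { rewrite !Cmod_mult, Cmod_R, Rabs_right, Cmod_pow by (apply Rle_ge, pos_INR).
    fold d. destruct n as [|n]; [simpl; lra|].
    simpl pred.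
    assert (H1 : (Cmod X ^ n <= M ^ n)%R)
      by (apply pow_incr; split; [apply Cmod_ge_0|exact HX]).
    assert (H2 : (Cmod X * Cmod X * Cmod Y <= M * M * M)%R).
    { pose proof (Cmod_ge_0 X). pose proof (Cmod_ge_0 Y).
      apply Rmult_le_compat; try assumption; [apply Rmult_le_pos; assumption|].
      apply Rmult_le_compat; assumption. }
    assert (H3 : (Cmod X ^ n * (Cmod X * Cmod X * Cmod Y * (d * d))
                  <= M ^ (S n + 2) * d ^ 2)%R).
    { replace (M ^ (S n + 2) * d ^ 2)%R with (M ^ n * (M * M * M * (d * d)))%R
        by (rewrite pow_add; simpl pow; ring).
      pose proof (Cmod_ge_0 X). pose proof (Cmod_ge_0 Y).
      apply Rmult_le_compat; try exact H1.
      - apply pow_le; assumption.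
      - apply Rmult_le_pos; [|nra]. apply Rmult_le_pos; [nra|assumption].
      - apply Rmult_le_compat_r; [nra|exact H2]. }
    assert (1 <= INR (S n))%R by (rewrite S_INR; pose proof (pos_INR n); lra).
    set (N := INR (S n)) in *. set (P := (M ^ (S n + 2) * d ^ 2)%R) in *.
    replace (N ^ 2 * M ^ (S n + 2) * d ^ 2)%R with (N * (N * P))%R
      by (unfold P; ring).
    apply Rmult_le_compat_l; [lra|].
    assert (0 <= P)%R.
    { unfold P. apply Rmult_le_pos; [apply pow_le; lra|apply pow2_ge_0]. }
    nra. }
  eapply Rle_trans; [apply Cmod_triangle|]. lra.
Qed.

(** What is needed of a power series [A] with constant term [alpha] and
    derivative [dA]; a single constant serves for every bound so that two
    series can share it. *)
Definition tame_expansion (alpha : C) (L sigma : R) (A dA : C -> C) : Prop :=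
  forall x, (Cmod x <= sigma)%R ->
    (Cmod (A x) <= L)%R /\ (Cmod (dA x) <= L)%R /\
    (Cmod (A x - alpha) <= L * Cmod x)%R /\
    forall y, (Cmod y <= sigma)%R ->
      (Cmod (A y - A x - dA x * (y - x)) <= L * Cmod (y - x) ^ 2)%R.

Lemma tame_expansion_le (alpha : C) (L L' sigma : R) (A dA : C -> C) :
  (L <= L')%R -> tame_expansion alpha L sigma A dA ->
  tame_expansion alpha L' sigma A dA.
Proof.
  intros HL H x Hx. destruct (H x Hx) as (H1 & H2 & H3 & H4).
  split; [lra|]. split; [lra|]. split.
  - pose proof (Cmod_ge_0 x). nra.
  - intros y Hy. pose proof (H4 y Hy). pose proof (pow2_ge_0 (Cmod (y - x))). nra.
Qed.

Definition polar_part (n : nat) (A : C -> C) (x : C) : C := (/ x) ^ n * A x.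

Definition polar_deriv (n : nat) (A dA : C -> C) (x : C) : C :=
  (/ x) ^ n * dA x - INR n * (/ x) ^ S n * A x.

(** Product rule for quadratic remainders.  The pole contributes the dominant
    power [M^(n+2)]; [1 <= M] absorbs the others into it. *)
Lemma polar_part_taylor (n : nat) (alpha : C) (L sigma M : R) (A dA : C -> C) (x y : C) :
  (1 <= n)%nat -> (1 <= M)%R -> (0 < L)%R ->
  tame_expansion alpha L sigma A dA ->
  x <> 0 -> y <> 0 -> (Cmod x <= sigma)%R -> (Cmod y <= sigma)%R ->
  (Cmod (/ x) <= M)%R -> (Cmod (/ y) <= M)%R ->
  (Cmod (polar_part n A y - polar_part n A x - polar_deriv n A dA x * (y - x))
   <= 4 * INR n ^ 2 * L * M ^ (n + 2) * Cmod (y - x) ^ 2)%R.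
Proof.
  intros Hn HM HL HA Hx Hy Hxs Hys HX HY.
  destruct (HA x Hxs) as (HA1 & HA2 & _ & HA4). specialize (HA4 y Hys).
  unfold polar_part, polar_deriv.
  pose proof (Cinv_pow_lipschitz n x y M Hx Hy HX HY) as H1.
  pose proof (Cinv_pow_taylor n x y M Hx Hy HX HY) as H2.
  assert (H0 : (Cmod ((/ y) ^ n) <= M ^ n)%R).
  { rewrite Cmod_pow. apply pow_incr. split; [apply Cmod_ge_0|exact HY]. }
  set (Yn := (/ y) ^ n) in *. set (Xn := (/ x) ^ n) in *.
  set (V := INR n * (/ x) ^ S n) in *.
  replace (Yn * A y - Xn * A x - (Xn * dA x - V * A x) * (y - x))
    with (Yn * (A y - A x - dA x * (y - x)) + (Yn - Xn) * (dA x * (y - x))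
          + A x * (Yn - Xn + V * (y - x))) by ring.
  set (d := Cmod (y - x)) in *.
  assert (Hd : (0 <= d)%R) by apply Cmod_ge_0.
  assert (HN : (1 <= INR n)%R) by (apply (le_INR 1); exact Hn).
  assert (HMn : (1 <= M ^ n)%R) by (apply pow_R1_Rle; exact HM).
  assert (B1 : (Cmod (Yn * (A y - A x - dA x * (y - x))) <= M ^ n * (L * d ^ 2))%R).
  { rewrite Cmod_mult. apply Rmult_le_compat; auto using Cmod_ge_0. }
  assert (B2 : (Cmod ((Yn - Xn) * (dA x * (y - x)))
                <= (INR n * M ^ S n * d) * (L * d))%R).
  { rewrite !Cmod_mult. apply Rmult_le_compat; auto using Cmod_ge_0.
    - apply Rmult_le_pos; apply Cmod_ge_0.
    - apply Rmult_le_compat_r; auto. }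
  assert (B3 : (Cmod (A x * (Yn - Xn + V * (y - x)))
                <= L * (2 * INR n ^ 2 * M ^ (n + 2) * d ^ 2))%R).
  { rewrite Cmod_mult. apply Rmult_le_compat; auto using Cmod_ge_0. }
  eapply Rle_trans; [apply Cmod_triangle|].
  eapply Rle_trans; [apply Rplus_le_compat_r, Cmod_triangle|].
  set (P := (M ^ (n + 2) * (L * d ^ 2))%R).
  assert (HP : (0 <= L * d ^ 2)%R) by (apply Rmult_le_pos; [lra|apply pow2_ge_0]).
  assert (C1 : (M ^ n * (L * d ^ 2) <= P)%R).
  { apply Rmult_le_compat_r; [exact HP|]. apply Rle_pow; [exact HM|lia]. }
  assert (C2 : (M ^ S n * (L * d ^ 2) <= P)%R).
  { apply Rmult_le_compat_r; [exact HP|]. apply Rle_pow; [exact HM|lia]. }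
  assert (HP0 : (0 <= P)%R) by (eapply Rle_trans; [|exact C1];
    apply Rmult_le_pos; lra).
  replace (4 * INR n ^ 2 * L * M ^ (n + 2) * d ^ 2)%R with (4 * INR n ^ 2 * P)%R
    by (unfold P; ring).
  replace (INR n * M ^ S n * d * (L * d))%R with (INR n * (M ^ S n * (L * d ^ 2)))%R
    in B2 by ring.
  replace (L * (2 * INR n ^ 2 * M ^ (n + 2) * d ^ 2))%R with (2 * INR n ^ 2 * P)%R
    in B3 by (unfold P; ring).
  assert (INR n * (M ^ S n * (L * d ^ 2)) <= INR n * P)%R
    by (apply Rmult_le_compat_l; lra).
  assert (INR n * P <= INR n ^ 2 * P)%R by (apply Rmult_le_compat_r; nra).
  assert (P <= INR n ^ 2 * P)%R by nra.
  lra.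
Qed.

(** The leading term of the derivative is [- n alpha x^(-n-1)].  In the
    remainder, [|A x - alpha| <= L |x|] lowers the order of the pole by one. *)
Lemma polar_deriv_leading (n : nat) (alpha : C) (L sigma M : R) (A dA : C -> C) (x : C) :
  (0 < L)%R -> tame_expansion alpha L sigma A dA ->
  x <> 0 -> (Cmod x <= sigma)%R -> (Cmod (/ x) <= M)%R ->
  (Rabs (Cmod (polar_deriv n A dA x) - INR n * Cmod (/ x) ^ S n * Cmod alpha)
   <= (INR n + 1) * L * M ^ n)%R.
Proof.
  intros HL HA Hx Hxs HX.
  destruct (HA x Hxs) as (_ & HA2 & HA3 & _).
  set (V := INR n * (/ x) ^ S n * alpha).
  assert (HV : Cmod V = (INR n * Cmod (/ x) ^ S n * Cmod alpha)%R).
  { unfold V. rewrite !Cmod_mult, Cmod_pow, Cmod_R, Rabs_right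
      by (apply Rle_ge, pos_INR). reflexivity. }
  rewrite <- HV.
  set (D := polar_deriv n A dA x).
  assert (E : (Cmod (D + V) <= (INR n + 1) * L * M ^ n)%R).
  { unfold D, V, polar_deriv.
    replace ((/ x) ^ n * dA x - INR n * (/ x) ^ S n * A x + INR n * (/ x) ^ S n * alpha)
      with ((/ x) ^ n * dA x + - (INR n * ((/ x) ^ n * (/ x * (A x - alpha)))))
      by (rewrite Cpow_S; ring).
    assert (Hp : (Cmod (/ x) ^ n <= M ^ n)%R)
      by (apply pow_incr; split; [apply Cmod_ge_0|exact HX]).
    assert (Hq : (Cmod (/ x * (A x - alpha)) <= L)%R).
    { pose proof (proj1 (Cmod_gt_0 x) Hx) as Hpos.
      rewrite Cmod_mult, Cmod_inv by exact Hx.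
      apply Rmult_le_reg_l with (Cmod x); [exact Hpos|].
      rewrite <- Rmult_assoc, Rinv_r by lra. lra. }
    eapply Rle_trans; [apply Cmod_triangle|].
    rewrite Cmod_opp, (Cmod_mult _ (dA x)), (Cmod_mult (INR n)),
      (Cmod_mult _ (/ x * (A x - alpha))), !Cmod_pow, Cmod_R, Rabs_right
      by (apply Rle_ge, pos_INR).
    assert (0 <= Cmod (/ x) ^ n)%R by (apply pow_le, Cmod_ge_0).
    assert (Cmod (/ x) ^ n * Cmod (dA x) <= M ^ n * L)%R
      by (apply Rmult_le_compat; auto using Cmod_ge_0).
    assert (Cmod (/ x) ^ n * Cmod (/ x * (A x - alpha)) <= M ^ n * L)%R
      by (apply Rmult_le_compat; auto using Cmod_ge_0).
    pose proof (pos_INR n). nra. }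
  pose proof (Cmod_triangle (D + V) (- V)) as T1.
  pose proof (Cmod_triangle (D + V) (- D)) as T2.
  replace (D + V + - V) with D in T1 by ring.
  replace (D + V + - D) with V in T2 by ring.
  rewrite Cmod_opp in T1, T2. apply Rabs_le. lra.
Qed.

(** Here [M = 2 / |w|], so that the disk about [w] has radius [1 / M = |w| / 2] and
    [M] bounds [|1/x|] on it.  The limit is located within [|w| / (2 n)] of
    the initial point, half the separation of [n]-th roots given by
    [Cpow_roots_separated]. *)
Lemma newton_near_pole (n : nat) (alpha beta : C) (L sigma : R) (A dA B dB : C -> C) :
  (1 <= n)%nat -> Cmod alpha <> Cmod beta -> (0 < L)%R -> (0 < sigma)%R ->
  tame_expansion alpha L sigma A dA -> tame_expansion beta L sigma B dB ->
  exists M0 : R, (1 <= M0)%R /\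
    forall (M : R) (h g : C -> C) (z0 a0 b0 w : C),
      (M0 < M)%R -> Cmod w = (2 / M)%R ->
      (forall z, (0 < Cmod (z - z0) <= sigma)%R -> h z = a0 + polar_part n A (z - z0)) ->
      (forall z, (0 < Cmod (z - z0) <= sigma)%R -> g z = b0 + polar_part n B (z - z0)) ->
      alpha * (/ w) ^ n + Cconj (beta * (/ w) ^ n) = - (a0 + Cconj b0) ->
      newton_well_defined (fun x => (Cmod (x - (z0 + w)) < / M)%R) h g (z0 + w) /\
      exists xi : C,
        filterlim (newton h g (z0 + w)) eventually (locally xi) /\
        harmonic h g xi = 0 /\
        (Cmod (xi - (z0 + w)) < / (INR n * M))%R.
Proof.
  intros Hn Hab HL Hsig HA HB.
  assert (HN : (1 <= INR n)%R) by (apply (le_INR 1); exact Hn).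
  set (N := INR n) in *.
  set (dlt := Rabs (Cmod alpha - Cmod beta)).
  assert (Hdlt : (0 < dlt)%R) by (apply Rabs_pos_lt; lra).
  (* Half of the leading term [n * (M/4)^(n+1) * dlt] is kept as lower bound:
     [mu = m0 * M^(n+1)] below.  The other half pays for the remainders. *)
  set (m0 := (N * dlt / (2 * 4 ^ S n))%R).
  assert (H4 : (0 < 4 ^ S n)%R) by (apply pow_lt; lra).
  assert (Hm0 : (0 < m0)%R) by (apply Rdiv_lt_0_compat; nra).
  (* In order: the disk lies where the expansions hold; the remainders of the
     derivatives are below [mu]; the Kantorovich quantity is small; the limit is
     close enough to the initial point. *)
  set (c1 := (3 / sigma)%R). set (c2 := (2 * (N + 1) * L / m0)%R).
  set (c3 := (64 * N ^ 2 * L ^ 2 / m0 ^ 2)%R). set (c4 := (8 * N * L / m0)%R).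
  assert (Hc1 : (0 < c1)%R) by (apply Rdiv_lt_0_compat; lra).
  assert (Hc2 : (0 < c2)%R) by (apply Rdiv_lt_0_compat; nra).
  assert (Hc3 : (0 < c3)%R).
  { apply Rdiv_lt_0_compat; [|apply pow_lt; exact Hm0].
    apply Rmult_lt_0_compat; [|apply pow_lt; exact HL].
    apply Rmult_lt_0_compat; [lra|apply pow_lt; lra]. }
  assert (Hc4 : (0 < c4)%R) by (apply Rdiv_lt_0_compat; nra).
  exists (1 + c1 + c2 + c3 + c4)%R. split; [lra|].
  intros M h g z0 a0 b0 w HM Hw Hh Hg Hlead.
  assert (HM1 : (1 < M)%R) by lra.
  assert (K1 : (3 / M <= sigma)%R).
  { apply Rmult_le_reg_r with (M / sigma)%R; [apply Rdiv_lt_0_compat; lra|].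
    replace (3 / M * (M / sigma))%R with c1 by (unfold c1; field; lra).
    replace (sigma * (M / sigma))%R with M by (field; lra). lra. }
  assert (K2 : (2 * (N + 1) * L <= m0 * M)%R).
  { replace (2 * (N + 1) * L)%R with (m0 * c2)%R by (unfold c2; field; lra).
    apply Rmult_le_compat_l; lra. }
  assert (K3 : (64 * N ^ 2 * L ^ 2 <= m0 ^ 2 * M)%R).
  { replace (64 * N ^ 2 * L ^ 2)%R with (m0 ^ 2 * c3)%R by (unfold c3; field; lra).
    apply Rmult_le_compat_l; [apply pow2_ge_0|lra]. }
  assert (K4 : (8 * N * L < m0 * M)%R).
  { replace (8 * N * L)%R with (m0 * c4)%R by (unfold c4; field; lra).
    apply Rmult_lt_compat_l; lra. }
  clearbody c1 c2 c3 c4.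
  assert (HiM : (0 < / M)%R) by (apply Rinv_0_lt_compat; lra).
  assert (Hball : forall x, (Cmod (x - (z0 + w)) < / M)%R ->
    (/ M < Cmod (x - z0) < 3 / M)%R).
  { intros x Hx.
    pose proof (Cmod_triangle (x - (z0 + w)) w) as T1.
    pose proof (Cmod_triangle (x - z0) (- (x - (z0 + w)))) as T2.
    replace (x - (z0 + w) + w) with (x - z0) in T1 by ring.
    replace (x - z0 + - (x - (z0 + w))) with w in T2 by ring.
    rewrite Cmod_opp in T2. unfold Rdiv in *. lra. }
  assert (Hball' : forall x, (Cmod (x - (z0 + w)) < / M)%R ->
    x - z0 <> 0 /\ (Cmod (x - z0) <= sigma)%R /\ (0 < Cmod (x - z0) <= sigma)%R /\
    (M / 4 <= Cmod (/ (x - z0)) <= M)%R).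
  { intros x Hx. destruct (Hball x Hx) as [X1 X2].
    assert (X0 : x - z0 <> 0) by (apply Cmod_gt_0; lra).
    split; [exact X0|]. split; [lra|]. split; [lra|].
    rewrite Cmod_inv by exact X0. set (t := Cmod (x - z0)) in *. split.
    - replace (M / 4)%R with (/ (4 / M))%R by (field; lra).
      apply Rinv_le_contravar; [lra|]. unfold Rdiv in *. lra.
    - replace M with (/ / M)%R by (field; lra). apply Rinv_le_contravar; lra. }
  set (dh := fun z => polar_deriv n A dA (z - z0)).
  set (dg := fun z => polar_deriv n B dB (z - z0)).
  set (mu := (m0 * M ^ S n)%R).
  (* [|f| <= 2 * L * |w| * M^n = 4 * L * M^(n-1)] at the initial point, divided by [mu]. *)
  set (eta := (4 * L / (m0 * M ^ 2))%R).
  set (K := (4 * N ^ 2 * L * M ^ (n + 2))%R).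
  assert (HMn : (0 < M ^ n)%R) by (apply pow_lt; lra).
  assert (Heta : (2 * eta < / (N * M))%R).
  { apply Rmult_lt_reg_r with (m0 * M ^ 2 * N)%R.
    - apply Rmult_lt_0_compat; [|lra]. apply Rmult_lt_0_compat; [lra|apply pow_lt; lra].
    - replace (2 * eta * (m0 * M ^ 2 * N))%R with (8 * N * L)%R
        by (unfold eta; field; lra).
      replace (/ (N * M) * (m0 * M ^ 2 * N))%R with (m0 * M)%R by (field; lra).
      exact K4. }
  assert (HNM : (/ (N * M) <= / M)%R) by (apply Rinv_le_contravar; nra).
  assert (Htay : forall F E dE f0 eps0, tame_expansion eps0 L sigma E dE ->
    (forall z, (0 < Cmod (z - z0) <= sigma)%R -> F z = f0 + polar_part n E (z - z0)) ->
    forall x y, (Cmod (x - (z0 + w)) < / M)%R -> (Cmod (y - (z0 + w)) < / M)%R ->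
    (Cmod (F y - F x - polar_deriv n E dE (x - z0) * (y - x))
     <= K * Cmod (y - x) ^ 2)%R).
  { intros F E dE f0 e0 HE HF x y Hx Hy.
    destruct (Hball' x Hx) as (X0 & X1 & X2 & X3).
    destruct (Hball' y Hy) as (Y0 & Y1 & Y2 & Y3).
    rewrite (HF x X2), (HF y Y2).
    pose proof (polar_part_taylor n e0 L sigma M E dE (x - z0) (y - z0) Hn
      ltac:(lra) HL HE X0 Y0 X1 Y1 (proj2 X3) (proj2 Y3)) as T.
    replace (y - z0 - (x - z0)) with (y - x) in T by ring.
    fold N K in T.
    replace (f0 + polar_part n E (y - z0) - (f0 + polar_part n E (x - z0))
             - polar_deriv n E dE (x - z0) * (y - x))
      with (polar_part n E (y - z0) - polar_part n E (x - z0)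
            - polar_deriv n E dE (x - z0) * (y - x)) by ring.
    exact T. }
  assert (HtK : (0 <= K)%R).
  { unfold K. apply Rmult_le_pos; [|apply pow_le; lra].
    apply Rmult_le_pos; [|lra]. nra. }
  assert (Heta0 : (0 <= eta)%R).
  { unfold eta. apply Rdiv_le_0_compat; [lra|].
    apply Rmult_lt_0_compat; [exact Hm0|apply pow_lt; lra]. }
  assert (Hmu : (0 < mu)%R) by (apply Rmult_lt_0_compat; [exact Hm0|apply pow_lt; lra]).
  destruct (newton_converges h g dh dg (z0 + w) (/ M) K mu eta) as [Hwd [xi Hxi]];
    try assumption.
  - exact (Htay h A dA a0 alpha HA Hh).
  - exact (Htay g B dB b0 beta HB Hg).
  - intros x Hx. destruct (Hball' x Hx) as (X0 & X1 & X2 & X3).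
    pose proof (polar_deriv_leading n alpha L sigma M A dA _ HL HA X0 X1 (proj2 X3)) as P1.
    pose proof (polar_deriv_leading n beta L sigma M B dB _ HL HB X0 X1 (proj2 X3)) as P2.
    fold (dh x) in P1. fold (dg x) in P2. fold N in P1, P2.
    set (W := (N * Cmod (/ (x - z0)) ^ S n)%R) in *.
    assert (HW : (N * (M / 4) ^ S n <= W)%R).
    { apply Rmult_le_compat_l; [lra|]. apply pow_incr. lra. }
    assert (HW2 : (2 * mu <= W * dlt)%R).
    { apply Rle_trans with (N * (M / 4) ^ S n * dlt)%R.
      - unfold mu, m0. unfold Rdiv at 2. rewrite Rpow_mult_distr, pow_inv.
        right. field. lra.
      - apply Rmult_le_compat_r; lra. }
    assert (Hsmall : (2 * ((N + 1) * L * M ^ n) <= mu)%R).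
    { unfold mu. simpl pow. nra. }
    assert (Hdl : (W * dlt = Rabs (W * Cmod alpha - W * Cmod beta))%R).
    { unfold dlt. rewrite <- Rmult_minus_distr_l, Rabs_mult, (Rabs_right W).
      - reflexivity.
      - apply Rle_ge. eapply Rle_trans; [|exact HW].
        apply Rmult_le_pos; [lra|apply pow_le; lra]. }
    rewrite Hdl in HW2.
    apply Rabs_le_between in P1. apply Rabs_le_between in P2.
    unfold Rabs in HW2 |- *.
    destruct (Rcase_abs (W * Cmod alpha - W * Cmod beta));
    destruct (Rcase_abs (Cmod (dh x) - Cmod (dg x))); lra.
  - assert (Hw0 : w <> 0) by (apply Cmod_gt_0; rewrite Hw; apply Rdiv_lt_0_compat; lra).
    assert (Hws : (Cmod w <= sigma)%R) by (rewrite Hw; unfold Rdiv in *; lra).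
    assert (Ew : z0 + w - z0 = w) by ring.
    unfold harmonic. rewrite Hh, Hg, Ew by
      (rewrite Ew; split; [apply Cmod_gt_0; exact Hw0|exact Hws]).
    unfold polar_part.
    replace (a0 + (/ w) ^ n * A w + Cconj (b0 + (/ w) ^ n * B w))
      with ((/ w) ^ n * (A w - alpha) + Cconj ((/ w) ^ n * (B w - beta))).
    + destruct (HA w Hws) as (_ & _ & HA3 & _). destruct (HB w Hws) as (_ & _ & HB3 & _).
      eapply Rle_trans; [apply Cmod_triangle|].
      rewrite Cmod_conj, !Cmod_mult, Cmod_pow, Cmod_inv, Hw by exact Hw0.
      rewrite Hw in HA3, HB3.
      assert (Hp : (0 < (/ (2 / M)) ^ n <= M ^ n)%R).
      { replace (/ (2 / M))%R with (M / 2)%R by (field; lra).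
        split; [apply pow_lt; lra|apply pow_incr; lra]. }
      replace (mu * eta)%R with (2 * (M ^ n * (L * (2 / M))))%R
        by (unfold mu, eta; simpl pow; field; lra).
      assert (forall q, (0 <= q <= L * (2 / M))%R ->
        ((/ (2 / M)) ^ n * q <= M ^ n * (L * (2 / M)))%R) as Hq.
      { intros q Hq. apply Rmult_le_compat; lra. }
      pose proof (Hq _ (conj (Cmod_ge_0 _) HA3)).
      pose proof (Hq _ (conj (Cmod_ge_0 _) HB3)). lra.
    + rewrite Cmult_conj in Hlead.
      rewrite Cplus_conj, !Cmult_conj, Cminus_conj.
      set (u := (/ w) ^ n) in *.
      replace (u * (A w - alpha) + Cconj u * (Cconj (B w) - Cconj beta))
        with (u * A w + Cconj u * Cconj (B w) - (alpha * u + Cconj beta * Cconj u))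
        by ring.
      rewrite Hlead. ring.
  - unfold mu. apply Rmult_le_reg_r with m0; [exact Hm0|].
    replace (4 * K * eta * m0)%R with (M ^ n * (64 * N ^ 2 * L ^ 2))%R
      by (unfold K, eta; rewrite pow_add; field; lra).
    replace (m0 * M ^ S n * m0)%R with (M ^ n * (m0 ^ 2 * M))%R by (simpl pow; ring).
    apply Rmult_le_compat_l; lra.
  - lra.
  - split; [exact Hwd|]. exists xi. destruct Hxi as (X1 & X2 & X3).
    split; [exact X1|]. split; [exact X2|]. lra.
Qed.
(** * Splitting a Laurent series *)

Lemma CpowZ_sub (w : C) (m n : nat) :
  w <> 0 -> CpowZ w (Z.of_nat m - Z.of_nat n) = w ^ m * (/ w) ^ n.
Proof.
  intros Hw.
  assert (Hs : forall k j : nat, w ^ (k + j) * (/ w) ^ k = w ^ j).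
  { intros k j. rewrite Cpow_add_r, Cpow_inv by exact Hw. field.
    apply Cpow_nz, Hw. }
  destruct (Z.of_nat m - Z.of_nat n)%Z as [|p|p] eqn:E; simpl.
  - replace m with (n + 0)%nat by lia. rewrite Hs. reflexivity.
  - replace m with (n + Pos.to_nat p)%nat by lia. rewrite Hs. reflexivity.
  - replace n with (m + Pos.to_nat p)%nat by lia.
    rewrite Cpow_add_r, !Cpow_inv by exact Hw. field.
    split; apply Cpow_nz, Hw.
Qed.

(** The coefficient of exponent 0 sits at index [m = n] of the series. *)
Lemma is_laurent_shift_coeff0 (n : nat) (a : Z -> C) (a0 z0 z l : C) :
  is_laurent n (with_coeff0 a a0) z0 z l ->
  is_laurent n (with_coeff0 a 0) z0 z (l - a0).
Proof.
  intros H. unfold is_laurent.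
  apply is_series_ext with (2 := is_series_Cminus _ _ _ _ H (is_series_single n a0)).
  intros m. match goal with |- ?x = ?y => change (@eq C x y) end.
  unfold with_coeff0.
  destruct (Nat.eqb_spec m n) as [->|E].
  - rewrite Z.sub_diag. simpl. ring.
  - destruct (Z.eqb_spec (Z.of_nat m - Z.of_nat n) 0); [lia|]. ring.
Qed.

Lemma is_laurent_power_series (n : nat) (a : Z -> C) (z0 z l : C) :
  z - z0 <> 0 -> is_laurent n a z0 z l ->
  is_series (fun m => a (Z.of_nat m - Z.of_nat n)%Z * (z - z0) ^ m)
    ((z - z0) ^ n * l).
Proof.
  intros Hz H.
  apply is_series_ext with (2 := is_series_Cscal ((z - z0) ^ n) _ _ H).
  intros m. match goal with |- ?x = ?y => change (@eq C x y) end.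
  rewrite CpowZ_sub, Cpow_inv by exact Hz. field. apply Cpow_nz, Hz.
Qed.

(** The constants and functions are chosen from the coefficients other than the
    constant one, before any function [h] is given.  If some Laurent series with these
    coefficients converges, they satisfy a Cauchy bound at radius [r / 2].
    Otherwise no [h] exists, and a constant [A] meets the remaining clause. *)
Lemma laurent_tame_expansion (n : nat) (a : Z -> C) (r : R) :
  (1 <= n)%nat -> (0 < r)%R ->
  exists (L : R) (A dA : C -> C), (0 < L)%R /\
    tame_expansion (a (- Z.of_nat n)%Z) L (r / 16) A dA /\
    forall (z0 a0 : C) (h : C -> C),
      (forall z, punctured_disk z0 r z ->
         is_laurent n (with_coeff0 a a0) z0 z (h z)) ->
      forall z, (0 < Cmod (z - z0) <= r / 16)%R ->
        h z = a0 + polar_part n A (z - z0).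
Proof.
  intros Hn Hr.
  set (alpha := fun m : nat => with_coeff0 a 0 (Z.of_nat m - Z.of_nat n)%Z).
  assert (Halpha0 : alpha 0%nat = a (- Z.of_nat n)%Z).
  { unfold alpha, with_coeff0. simpl Z.of_nat. rewrite Z.sub_0_l.
    destruct (Z.eqb_spec (- Z.of_nat n) 0); [lia|reflexivity]. }
  assert (Hser : forall (z0 a0 : C) (h : C -> C),
    (forall z, punctured_disk z0 r z ->
       is_laurent n (with_coeff0 a a0) z0 z (h z)) ->
    forall z, punctured_disk z0 r z ->
      is_series (fun m => alpha m * (z - z0) ^ m) ((z - z0) ^ n * (h z - a0))).
  { intros z0 a0 h Hh z Hz. apply is_laurent_power_series.
    - apply Cmod_gt_0. apply Hz.
    - apply is_laurent_shift_coeff0, Hh, Hz. }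
  destruct (classic (exists B : R, forall m, (Cmod (alpha m) * (r / 2) ^ m <= B)%R))
    as [[B HB]|Hno].
  - destruct (power_series_taylor alpha B (r / 2) ltac:(lra) HB)
      as (L & A & dA & HL & HA).
    replace (r / 2 / 8)%R with (r / 16)%R in HA by field.
    exists L, A, dA. split; [exact HL|]. split.
    + intros x Hx. destruct (HA x Hx) as (_ & HA'). rewrite <- Halpha0. exact HA'.
    + intros z0 a0 h Hh z Hz.
      assert (Hz0 : z - z0 <> 0) by (apply Cmod_gt_0; lra).
      assert (Hzr : punctured_disk z0 r z) by (unfold punctured_disk; lra).
      assert (E : (z - z0) ^ n * (h z - a0) = A (z - z0)).
      { apply (filterlim_locally_unique (V := C_NormedModule) (F := eventually)
          (sum_n (fun m => alpha m * (z - z0) ^ m))).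
        - exact (Hser z0 a0 h Hh z Hzr).
        - apply (HA (z - z0)). lra. }
      unfold polar_part. rewrite <- E, Cpow_inv by exact Hz0.
      field. apply Cpow_nz, Hz0.
  - exists (1 + Cmod (a (- Z.of_nat n)%Z))%R, (fun _ => a (- Z.of_nat n)%Z), (fun _ => RtoC 0).
    assert (Hz : forall c : C, Cmod (c - c) = 0%R).
    { intros c. replace (c - c) with (RtoC 0) by ring. apply Cmod_0. }
    pose proof (Cmod_ge_0 (a (- Z.of_nat n)%Z)) as Hpos.
    split; [lra|]. split.
    + intros x Hx. rewrite Hz, Cmod_0. pose proof (Cmod_ge_0 x).
      split; [lra|]. split; [lra|]. split; [nra|]. intros y Hy.
      rewrite Cmult_0_l. unfold Cminus at 1. rewrite Copp_0, Cplus_0_r, Hz.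
      apply Rmult_le_pos; [lra|apply pow2_ge_0].
    + intros z0 a0 h Hh. exfalso. apply Hno.
      assert (Ez : Cmod (z0 + RtoC (r / 2) - z0) = (r / 2)%R).
      { replace (z0 + RtoC (r / 2) - z0) with (RtoC (r / 2)) by ring.
        rewrite Cmod_R, Rabs_right; lra. }
      destruct (is_series_term_bounded _ _ (Hser z0 a0 h Hh (z0 + RtoC (r / 2))
        ltac:(unfold punctured_disk; lra))) as [B HB].
      exists B. intros m. specialize (HB m).
      rewrite Cmod_mult, Cmod_pow, Ez in HB. exact HB.
Qed.

(** * Roots of complex numbers *)

Lemma pow_inj_base (n : nat) (x y : R) :
  (1 <= n)%nat -> (0 <= x)%R -> (0 <= y)%R -> (x ^ n = y ^ n)%R -> x = y.
Proof.
  intros Hn.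
  assert (Hlt : forall u v, (0 <= u)%R -> (u < v)%R -> (u ^ n < v ^ n)%R).
  { intros u v Hu Huv. destruct n as [|m]; [lia|]. simpl pow.
    pose proof (pow_incr u v m ltac:(lra)). pose proof (pow_lt v m ltac:(lra)).
    apply Rle_lt_trans with (u * v ^ m)%R.
    - apply Rmult_le_compat_l; assumption.
    - apply Rmult_lt_compat_r; assumption. }
  intros Hx Hy E.
  destruct (Rtotal_order x y) as [L|[L|L]]; [|exact L|].
  - pose proof (Hlt x y Hx L). lra.
  - pose proof (Hlt y x Hy L). lra.
Qed.

(** If [x^n = y^n], the remainder in [Cpow_taylor] reduces to its linear term, and
    [n |x|^(n-1) |y - x| <= n^2 |x|^(n-2) |y - x|^2]. *)
Lemma Cpow_roots_separated (n : nat) (x y : C) :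
  (1 <= n)%nat -> x ^ n = y ^ n -> x <> y -> (Cmod x <= INR n * Cmod (y - x))%R.
Proof.
  intros Hn E Hne.
  assert (HN : (1 <= INR n)%R) by (apply (le_INR 1); exact Hn).
  assert (Em : Cmod x = Cmod y).
  { assert (Ep : (Cmod x ^ n = Cmod y ^ n)%R) by (rewrite <- !Cmod_pow, E; reflexivity).
    apply (pow_inj_base n); auto using Cmod_ge_0. }
  pose proof (Cpow_taylor n x y (Cmod x) ltac:(lra) ltac:(lra)) as T.
  rewrite E in T.
  destruct (Req_dec (Cmod x) 0) as [E0|N0].
  { pose proof (Cmod_ge_0 (y - x)). rewrite E0. nra. }
  pose proof (Cmod_ge_0 x).
  assert (Hp : (0 < Cmod x)%R) by lra.
  assert (Hd : (0 < Cmod (y - x))%R).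
  { apply Cmod_gt_0. intros Z. apply Hne. symmetry. apply Ceq_minus, Z. }
  replace (y ^ n - y ^ n - INR n * x ^ pred n * (y - x))
    with (- (INR n * (x ^ pred n * (y - x)))) in T by ring.
  rewrite Cmod_opp, !Cmod_mult, Cmod_pow, Cmod_R, Rabs_right in T
    by (apply Rle_ge, pos_INR).
  destruct n as [|n]; [lia|]. simpl pred in T.
  set (N := INR (S n)) in *. set (s := Cmod x) in *. set (d := Cmod (y - x)) in *.
  assert (Hpn : (0 < s ^ n)%R) by (apply pow_lt; exact Hp).
  apply Rmult_le_reg_l with (N * (s ^ n * d) * s)%R.
  - apply Rmult_lt_0_compat; [|exact Hp]. apply Rmult_lt_0_compat; [lra|].
    apply Rmult_lt_0_compat; assumption.
  - simpl pow in T. nra.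
Qed.

Definition cis (t : R) : C := (cos t, sin t).

Lemma cis_add (s t : R) : cis (s + t) = cis s * cis t.
Proof.
  unfold cis, Cmult; simpl. rewrite cos_plus, sin_plus. f_equal; ring.
Qed.

Lemma cis_pow (t : R) (k : nat) : cis t ^ k = cis (INR k * t).
Proof.
  induction k as [|k IH].
  - simpl. unfold cis. rewrite Rmult_0_l, cos_0, sin_0. reflexivity.
  - rewrite Cpow_S, IH, S_INR, <- cis_add. f_equal. ring.
Qed.

(** The half-angle formula [cos t = 1 - 2 sin (t/2)^2] reduces both directions to
    the zeros of the sine. *)
Lemma cis_eq_1 (t : R) : cis t = 1 <-> exists k : Z, t = (2 * PI * IZR k)%R.
Proof.
  assert (Ec : cos t = (1 - 2 * sin (t / 2) * sin (t / 2))%R).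
  { rewrite <- cos_2a_sin. f_equal. field. }
  assert (Es : sin t = (2 * sin (t / 2) * cos (t / 2))%R).
  { rewrite <- sin_2a. f_equal. field. }
  split.
  - intros E. injection E as E1 E2.
    destruct (sin_eq_0_0 (t / 2)) as [k Hk]; [nra|].
    exists k. lra.
  - intros [k Hk].
    assert (E0 : sin (t / 2) = 0%R).
    { apply sin_eq_0_1. exists k. rewrite Hk. field. }
    unfold cis. rewrite Ec, Es, E0. apply injective_projections; simpl; ring.
Qed.

Lemma Cmod_cis (t : R) : Cmod (cis t) = 1%R.
Proof.
  unfold Cmod, cis; simpl.
  replace (cos t * (cos t * 1) + sin t * (sin t * 1))%R with 1%R.
  - apply sqrt_1.
  - pose proof (sin2_cos2 t) as H. unfold Rsqr in H. lra.
Qed.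

Lemma cis_nz (t : R) : cis t <> 0.
Proof. apply Cmod_gt_0. rewrite Cmod_cis. lra. Qed.

Lemma unit_is_cis (z : C) : Cmod z = 1%R -> exists t : R, z = cis t.
Proof.
  intros H.
  assert (E : (Re z ^ 2 + Im z ^ 2 = 1)%R) by (rewrite <- Cmod2_alt, H; ring).
  destruct z as [p q]. simpl in E.
  assert (Hp : (-1 <= p <= 1)%R) by nra.
  assert (Hs : sqrt (1 - Rsqr p) = Rabs q).
  { rewrite <- sqrt_Rsqr_abs. f_equal. unfold Rsqr. lra. }
  destruct (Rle_dec 0 q) as [Hq|Hq].
  - exists (acos p). unfold cis. rewrite cos_acos, sin_acos, Hs by exact Hp.
    rewrite Rabs_right by lra. reflexivity.
  - exists (- acos p)%R. unfold cis.
    rewrite cos_neg, sin_neg, cos_acos, sin_acos, Hs by exact Hp.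
    rewrite Rabs_left, Ropp_involutive by lra. reflexivity.
Qed.


Lemma exists_nth_root (n : nat) (Q : C) :
  (1 <= n)%nat -> Q <> 0 -> exists z : C, z <> 0 /\ z ^ n = Q.
Proof.
  intros Hn HQ.
  assert (HN : (1 <= INR n)%R) by (apply (le_INR 1); exact Hn).
  pose proof (proj1 (Cmod_gt_0 Q) HQ) as Hq.
  assert (Hq' : RtoC (Cmod Q) <> 0) by (intros E; apply RtoC_inj in E; lra).
  destruct (unit_is_cis (Q / Cmod Q)) as [t Ht].
  { rewrite Cmod_div, Cmod_R, Rabs_right by (try exact Hq'; lra). field. lra. }
  assert (HR : (0 < Rpower (Cmod Q) (/ INR n))%R) by apply exp_pos.
  exists (RtoC (Rpower (Cmod Q) (/ INR n)) * cis (t / INR n)). split.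
  - apply Cmult_neq_0; [|apply cis_nz]. intros E. apply RtoC_inj in E. lra.
  - rewrite Cpow_mult_l, cis_pow, <- RtoC_pow, <- Rpower_pow, Rpower_mult by exact HR.
    rewrite Rinv_l, Rpower_1 by lra.
    replace (INR n * (t / INR n))%R with t by (field; lra).
    rewrite <- Ht. field. exact Hq'.
Qed.

Lemma nth_roots_enumerated (n : nat) (Q z0 : C) :
  (1 <= n)%nat -> Q <> 0 ->
  exists zs : nat -> C, enumerates n (fun z => (z - z0) ^ n = Q) zs.
Proof.
  intros Hn HQ.
  assert (HN : (1 <= INR n)%R) by (apply (le_INR 1); exact Hn).
  destruct (exists_nth_root n Q Hn HQ) as (rt & Hrt & HrtQ).
  set (th := fun j : nat => (2 * PI * (INR j / INR n))%R).
  assert (Hth : forall j, cis (th j) ^ n = 1).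
  { intros j. rewrite cis_pow. apply cis_eq_1. exists (Z.of_nat j).
    rewrite <- INR_IZR_INZ. unfold th. field. lra. }
  exists (fun j => z0 + rt * cis (th j)). split.
  - intros i j Hi Hj E.
    assert (Ec : cis (th i) = cis (th j)).
    { replace (cis (th i)) with ((z0 + rt * cis (th i) - z0) / rt) by (field; exact Hrt).
      rewrite E. field. exact Hrt. }
    assert (E1 : cis (th i - th j) = 1).
    { replace (th i) with (th i - th j + th j)%R in Ec by ring.
      rewrite cis_add in Ec.
      replace (cis (th i - th j)) with (cis (th i - th j) * cis (th j) / cis (th j))
        by (field; apply cis_nz).
      rewrite Ec. field. apply cis_nz. }
    apply cis_eq_1 in E1. destruct E1 as [k Hk].
    assert (Ek : (INR i - INR j = IZR k * INR n)%R).
    { apply Rmult_eq_reg_l with (2 * PI / INR n)%R.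
      - transitivity (th i - th j)%R; [unfold th; field; lra|].
        rewrite Hk. field. lra.
      - pose proof PI_RGT_0. apply Rgt_not_eq, Rdiv_lt_0_compat; lra. }
    rewrite !INR_IZR_INZ, <- minus_IZR, <- mult_IZR in Ek.
    apply eq_IZR in Ek. assert (k = 0%Z) by nia. subst k. lia.
  - intros z. split.
    + intros Hz.
      set (v := (z - z0) / rt).
      assert (Hv : v ^ n = 1).
      { unfold v, Cdiv. rewrite Cpow_mult_l, Hz, Cpow_inv, HrtQ by exact Hrt.
        apply Cinv_r, HQ. }
      assert (Hm : Cmod v = 1%R).
      { apply (pow_inj_base n); [exact Hn|apply Cmod_ge_0|lra|].
        rewrite <- Cmod_pow, Hv, pow1. apply Cmod_1. }
      destruct (unit_is_cis v Hm) as [t Ht].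
      rewrite Ht, cis_pow in Hv. apply cis_eq_1 in Hv. destruct Hv as [k Hk].
      pose proof (Z.mod_pos_bound k (Z.of_nat n) ltac:(lia)) as Hmod.
      pose proof (Z.div_mod k (Z.of_nat n) ltac:(lia)) as Hdiv.
      set (q := (k / Z.of_nat n)%Z) in *. set (m := (k mod Z.of_nat n)%Z) in *.
      exists (Z.to_nat m). split; [lia|].
      assert (Et : t = (2 * PI * IZR q + th (Z.to_nat m))%R).
      { apply Rmult_eq_reg_l with (INR n); [|lra].
        rewrite Hk, Hdiv, plus_IZR, mult_IZR, <- INR_IZR_INZ.
        unfold th. rewrite (INR_IZR_INZ (Z.to_nat m)), Z2Nat.id by lia. field. lra. }
      assert (Ev : v = cis (th (Z.to_nat m))).
      { rewrite Ht, Et, cis_add.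
        rewrite (proj2 (cis_eq_1 (2 * PI * IZR q))) by (exists q; reflexivity).
        apply Cmult_1_l. }
      rewrite <- Ev. unfold v. field. exact Hrt.
    + intros (j & Hj & <-).
      replace (z0 + rt * cis (th j) - z0) with (rt * cis (th j)) by ring.
      rewrite Cpow_mult_l, Hth, HrtQ. ring.
Qed.

(** [/ Q] is the solution of the real-linear equation [a u + conj (b u) = c].
    The last bound makes the initial points tend to the pole as [c] grows. *)
Lemma initial_equation (a b c : C) :
  Cmod a <> Cmod b -> c <> 0 ->
  let Q := RtoC (Cmod a ^ 2 - Cmod b ^ 2)%R / (Cconj a * c - Cconj b * Cconj c) in
  Q <> 0 /\ a * / Q + Cconj (b * / Q) = c /\
  (Cmod Q * Cmod c <= Cmod a + Cmod b)%R.
Proof.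
  intros Hab Hc.
  pose proof (Cmod_ge_0 a) as Ha. pose proof (Cmod_ge_0 b) as Hb.
  pose proof (proj1 (Cmod_gt_0 c) Hc) as Hcp.
  set (num := RtoC (Cmod a ^ 2 - Cmod b ^ 2)%R).
  assert (En : num = a * Cconj a - b * Cconj b).
  { unfold num. rewrite RtoC_minus, !Cmod2_conj. reflexivity. }
  assert (Hr : (Cmod a ^ 2 - Cmod b ^ 2)%R <> 0%R).
  { replace (Cmod a ^ 2 - Cmod b ^ 2)%R with ((Cmod a - Cmod b) * (Cmod a + Cmod b))%R
      by ring.
    apply Rmult_integral_contrapositive. split; [lra|].
    intros E. apply Hab. lra. }
  assert (Hn : num <> 0) by (intros E; apply RtoC_inj in E; contradiction).
  set (den := Cconj a * c - Cconj b * Cconj c).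
  assert (Hden : (Rabs (Cmod a - Cmod b) * Cmod c <= Cmod den)%R).
  { pose proof (Cmod_triangle den (Cconj b * Cconj c)) as T1.
    pose proof (Cmod_triangle (Cconj a * c) (- den)) as T2.
    replace (den + Cconj b * Cconj c) with (Cconj a * c) in T1 by (unfold den; ring).
    replace (Cconj a * c + - den) with (Cconj b * Cconj c) in T2 by (unfold den; ring).
    rewrite Cmod_opp in T2. rewrite !Cmod_mult, !Cmod_conj in T1, T2.
    unfold Rabs. destruct (Rcase_abs (Cmod a - Cmod b)); nra. }
  assert (Hd0 : (0 < Rabs (Cmod a - Cmod b))%R) by (apply Rabs_pos_lt; lra).
  assert (Hd : den <> 0).
  { apply Cmod_gt_0. eapply Rlt_le_trans; [|exact Hden].
    apply Rmult_lt_0_compat; assumption. }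
  intros Q.
  assert (EQ : / Q = den / num) by (unfold Q; field; auto).
  split; [|split].
  - unfold Q, Cdiv. apply Cmult_neq_0; [exact Hn|].
    intros E. apply C1_nz. rewrite <- (Cinv_r den Hd), E. ring.
  - rewrite EQ, Cmult_conj, Cdiv_conj by exact Hn.
    assert (Ecn : Cconj num = num).
    { rewrite En, Cminus_conj, !Cmult_conj, !Cconj_conj. ring. }
    rewrite Ecn. unfold den. rewrite Cminus_conj, !Cmult_conj, !Cconj_conj.
    rewrite En in Hn |- *. field. exact Hn.
  - unfold Q. rewrite Cmod_div by exact Hd.
    assert (Hdp : (0 < Cmod den)%R) by (apply Cmod_gt_0, Hd).
    apply Rmult_le_reg_r with (Cmod den); [exact Hdp|].
    replace (Cmod num / Cmod den * Cmod c * Cmod den)%R with (Cmod num * Cmod c)%R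
      by (field; lra).
    assert (Em : Cmod num = (Rabs (Cmod a - Cmod b) * (Cmod a + Cmod b))%R).
    { unfold num. rewrite Cmod_R.
      replace (Cmod a ^ 2 - Cmod b ^ 2)%R
        with ((Cmod a - Cmod b) * (Cmod a + Cmod b))%R by ring.
      rewrite Rabs_mult. f_equal. apply Rabs_right. lra. }
    rewrite Em.
    replace (Rabs (Cmod a - Cmod b) * (Cmod a + Cmod b) * Cmod c)%R
      with ((Cmod a + Cmod b) * (Rabs (Cmod a - Cmod b) * Cmod c))%R by ring.
    apply Rmult_le_compat_l; lra.
Qed.

(** * Zeros near the pole as limits of the iteration *)

Theorem theorem4p3 (n : nat) (hn : (1 <= n)%nat) (a b : Z -> C)
    (hab : Cmod (a (- Z.of_nat n)%Z) <> Cmod (b (- Z.of_nat n)%Z))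
    (r eps : R) (hr : (0 < r)%R) (heps : (0 < eps)%R) :
  exists M : R, (0 < M)%R /\
    forall (z0 a0 b0 : C) (h g : C -> C),
      (forall z : C, punctured_disk z0 r z ->
         is_laurent n (with_coeff0 a a0) z0 z (h z)) ->
      (forall z : C, punctured_disk z0 r z ->
         is_laurent n (with_coeff0 b b0) z0 z (g z)) ->
      let c : C := (- (a0 + Cconj b0))%C in
      let an : C := a (- Z.of_nat n)%Z in
      let bn : C := b (- Z.of_nat n)%Z in
      let initial_eq : C -> Prop := fun z : C =>
        ((z - z0) ^ n = RtoC (Cmod an ^ 2 - Cmod bn ^ 2)%R
                        / (Cconj an * c - Cconj bn * Cconj c))%C in
      c <> RtoC 0 ->
      (M < Cmod c)%R ->
      (exists zs : nat -> C, enumerates n initial_eq zs) /\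
      forall zs : nat -> C, enumerates n initial_eq zs ->
        exists xi : nat -> C,
          (forall i j : nat, (i < n)%nat -> (j < n)%nat -> i <> j -> xi i <> xi j) /\
          forall j : nat, (j < n)%nat ->
            newton_well_defined (punctured_disk z0 r) h g (zs j) /\
            filterlim (newton h g (zs j)) eventually (locally (xi j)) /\
            punctured_disk z0 r (xi j) /\
            harmonic h g (xi j) = RtoC 0 /\
            (Cmod (xi j - z0) < eps)%R.
Proof.
  assert (HN : (1 <= INR n)%R) by (apply (le_INR 1); exact hn).
  destruct (laurent_tame_expansion n a r hn hr) as (La & A & dA & HLa & HA & Hha).
  destruct (laurent_tame_expansion n b r hn hr) as (Lb & B & dB & HLb & HB & Hgb).
  destruct (newton_near_pole n _ _ (La + Lb)%R (r / 16) A dA B dB hn hab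
    ltac:(lra) ltac:(lra)
    (tame_expansion_le _ La (La + Lb) _ _ _ ltac:(lra) HA)
    (tame_expansion_le _ Lb (La + Lb) _ _ _ ltac:(lra) HB)) as (M0 & HM0 & Hnewton).
  (* Beyond [48 / r] and [3 / eps], the disk of radius [3 / M] about [z0], which
     contains all iterates, has radius less than [r] and [eps]. *)
  set (M1 := (M0 + 48 / r + 3 / eps)%R).
  assert (Hq1 : (0 < 48 / r)%R) by (apply Rdiv_lt_0_compat; lra).
  assert (Hq2 : (0 < 3 / eps)%R) by (apply Rdiv_lt_0_compat; lra).
  assert (HM1 : (0 < M1)%R) by (unfold M1; lra).
  set (S0 := (Cmod (a (- Z.of_nat n)%Z) + Cmod (b (- Z.of_nat n)%Z))%R).
  assert (HS0 : (0 <= S0)%R).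
  { unfold S0. pose proof (Cmod_ge_0 (a (- Z.of_nat n)%Z)).
    pose proof (Cmod_ge_0 (b (- Z.of_nat n)%Z)). lra. }
  assert (Hpw : (0 < (M1 / 2) ^ n)%R) by (apply pow_lt; lra).
  (* By [initial_equation], [|w|^n <= S0 / |c|], so this makes [2 / |w|] exceed
     [M1]. *)
  exists (S0 * (M1 / 2) ^ n + 1)%R. split.
  { assert (0 <= S0 * (M1 / 2) ^ n)%R by (apply Rmult_le_pos; lra). lra. }
  intros z0 a0 b0 h g Hh Hg c an bn initial_eq Hc HcM.
  destruct (initial_equation an bn c hab Hc) as (HQ0 & HQlead & HQmod).
  set (Q := RtoC (Cmod an ^ 2 - Cmod bn ^ 2)%R
            / (Cconj an * c - Cconj bn * Cconj c)) in *.
  split; [apply (nth_roots_enumerated n Q z0 hn HQ0)|].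
  intros zs [Hinj Hall].
  assert (Hroot : forall j, (j < n)%nat -> (zs j - z0) ^ n = Q).
  { intros j Hj. apply (Hall (zs j)). exists j. auto. }
  assert (Hcp : (0 < Cmod c)%R) by (apply Cmod_gt_0, Hc).
  assert (HQp : (0 < Cmod Q)%R) by (apply Cmod_gt_0, HQ0).
  assert (Hsp : forall j, (j < n)%nat ->
    (0 < Cmod (zs j - z0))%R /\ (M1 < 2 / Cmod (zs j - z0))%R).
  { intros j Hj. set (s := Cmod (zs j - z0)).
    assert (Es : (s ^ n = Cmod Q)%R).
    { unfold s. rewrite <- Cmod_pow, Hroot by exact Hj. reflexivity. }
    assert (Hs0 : (0 < s)%R).
    { destruct (Cmod_ge_0 (zs j - z0)) as [Hlt|Heq]; [exact Hlt|].
      fold s in Heq. rewrite <- Heq, pow_i in Es by lia. lra. }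
    split; [exact Hs0|].
    apply Rnot_le_lt. intros Hle.
    assert (H1 : (1 <= s * (M1 / 2))%R).
    { apply (Rmult_le_compat_l (s / 2)) in Hle; [|lra].
      replace (s / 2 * (2 / s))%R with 1%R in Hle by (field; lra). lra. }
    assert (H2 : (1 <= s ^ n * (M1 / 2) ^ n)%R).
    { rewrite <- Rpow_mult_distr. apply pow_R1_Rle, H1. }
    rewrite Es in H2. change (Cmod Q * Cmod c <= S0)%R in HQmod.
    assert (H3 : (1 * Cmod c <= Cmod Q * (M1 / 2) ^ n * Cmod c)%R)
      by (apply Rmult_le_compat_r; lra).
    assert (Cmod Q * Cmod c * (M1 / 2) ^ n <= S0 * (M1 / 2) ^ n)%R
      by (apply Rmult_le_compat_r; lra).
    lra. }
  assert (Hex : forall j, exists xi : C, (j < n)%nat ->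
    newton_well_defined (punctured_disk z0 r) h g (zs j) /\
    filterlim (newton h g (zs j)) eventually (locally xi) /\
    punctured_disk z0 r xi /\ harmonic h g xi = RtoC 0 /\
    (Cmod (xi - z0) < eps)%R /\
    (2 * INR n * Cmod (xi - zs j) < Cmod (zs j - z0))%R).
  { intros j. destruct (le_lt_dec n j) as [Hge|Hj].
    { exists 0. intros Hlt. lia. }
    destruct (Hsp j Hj) as [Hs HM].
    set (w := zs j - z0) in *. set (M := (2 / Cmod w)%R) in *.
    assert (HMp : (0 < M)%R) by lra.
    assert (Hw : Cmod w = (2 / M)%R) by (unfold M; field; lra).
    assert (Hwn : (/ w) ^ n = / Q).
    { rewrite Cpow_inv by (apply Cmod_gt_0, Hs). unfold w.
      rewrite Hroot by exact Hj. reflexivity. }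
    destruct (Hnewton M h g z0 a0 b0 w) as [Hwd (xi & X1 & X2 & X3)].
    - unfold M1 in HM. lra.
    - exact Hw.
    - exact (Hha z0 a0 h Hh).
    - exact (Hgb z0 b0 g Hg).
    - rewrite Hwn. exact HQlead.
    - replace (z0 + w) with (zs j) in * by (unfold w; ring).
      assert (HiM : (0 < / M)%R) by (apply Rinv_0_lt_compat; exact HMp).
      assert (H3r : (3 / M < r)%R /\ (3 / M < eps)%R).
      { assert (Hx : (48 < r * M)%R).
        { replace 48%R with (r * (48 / r))%R by (field; lra).
          apply Rmult_lt_compat_l; [lra|]. unfold M1 in HM. lra. }
        assert (Hy : (3 < eps * M)%R).
        { replace 3%R with (eps * (3 / eps))%R by (field; lra).
          apply Rmult_lt_compat_l; [lra|]. unfold M1 in HM. lra. }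
        split; apply Rmult_lt_reg_r with M; try exact HMp;
          replace (3 / M * M)%R with 3%R by (field; lra); lra. }
      assert (Hball : forall x, (Cmod (x - zs j) < / M)%R ->
        (0 < Cmod (x - z0) < 3 / M)%R).
      { intros x Hx. pose proof (Cmod_sub_triangle x (zs j) z0) as T1.
        pose proof (Cmod_sub_triangle (zs j) x z0) as T2.
        rewrite (Cmod_sub_sym (zs j) x) in T2. fold w in T1, T2.
        unfold Rdiv in *. lra. }
      assert (HNM : (/ (INR n * M) <= / M)%R) by (apply Rinv_le_contravar; nra).
      destruct (Hball xi ltac:(lra)) as [Y1 Y2].
      exists xi. intros _. split; [|split; [exact X1|split; [|split; [exact X2|split]]]].
      + intros k. destruct (Hwd k) as [W1 W2]. split; [|exact W2].
        destruct (Hball _ W1). unfold punctured_disk. lra.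
      + unfold punctured_disk. lra.
      + lra.
      + rewrite Hw.
        replace (2 / M)%R with (2 * INR n * / (INR n * M))%R by (field; lra).
        apply Rmult_lt_compat_l; [lra|exact X3]. }
  set (xi := fun j => proj1_sig (constructive_indefinite_description _ (Hex j))).
  assert (Hxi : forall j, (j < n)%nat -> _) by
    exact (fun j => proj2_sig (constructive_indefinite_description _ (Hex j))).
  cbv beta in Hxi. fold xi in Hxi.
  exists xi. split.
  - intros i j Hi Hj Hij E.
    destruct (Hxi i Hi) as (_ & _ & _ & _ & _ & Di).
    destruct (Hxi j Hj) as (_ & _ & _ & _ & _ & Dj).
    fold (xi i) in Di. fold (xi j) in Dj. rewrite <- E in Dj.
    assert (Es : Cmod (zs i - z0) = Cmod (zs j - z0)).
    { apply (pow_inj_base n); auto using Cmod_ge_0.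
      rewrite <- !Cmod_pow, !Hroot by assumption. reflexivity. }
    assert (Hsep : (Cmod (zs i - z0) <= INR n * Cmod (zs j - z0 - (zs i - z0)))%R).
    { apply Cpow_roots_separated; [exact hn|rewrite !Hroot by assumption; reflexivity|].
      intros Ez. apply Hij, Hinj; try assumption.
      replace (zs i) with (zs i - z0 + z0) by ring. rewrite Ez. ring. }
    replace (zs j - z0 - (zs i - z0)) with (zs j - zs i) in Hsep by ring.
    pose proof (Cmod_sub_triangle (zs j) (xi i) (zs i)) as T.
    (* A common limit would be closer than [s / (2 n)] to two initial points
       that are [s / n] apart. *)
    rewrite (Cmod_sub_sym (zs j) (xi i)) in T. nra.
  - intros j Hj. destruct (Hxi j Hj) as (X1 & X2 & X3 & X4 & X5 & _).
    exact (conj X1 (conj X2 (conj X3 (conj X4 X5)))).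
Qed.
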